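(* Let $S\subseteq\mathbb{R}^2_{\ge0}$ be a two-dimensional s-surface (a curve) written as $S=\{(x,\alpha(x)):0\le x\le a\}=\{(\beta(y),y):0\le y\le b\}$, where $a,b>0$ and $\alpha:[0,a]\to[0,b]$, $\beta=\alpha^{-1}:[0,b]\to[0,a]$ are strictly decreasing bijections. Assume that $S$ is strictly convex (that is, $\alpha$ is a strictly convex function) or strictly concave (that is, $\alpha$ is a strictly concave function). Then $$\mathrm{OPT}(S)=\sup\left\{\frac{\nabla S_j(p)}{\nabla S_i(p)} : p\in S \text{ with both coordinates strictly positive},\ i,j\in\{1,2\}\right\},$$ where $\nabla S_i(p)$ denotes the $i$-th coordinate of the outward normal vector $\nabla S(p)$ of $S$ at $p$.
   Context: Notation: $\mathbb{R}^2_{\ge0}=\{x\in\mathbb{R}^2: x_1,x_2\ge 0\}$; $x\le y$ means $x_i\le y_i$ for $i=1,2$; $\min(x,y)$ and $\max(x,y)$ are taken coordinatewise; $e_i$ is the $i$-th unit vector. EL function: a function $f:\mathbb{R}^2_{\ge0}\to\mathbb{R}$ is entropy-like (EL) if (1) it is submodular: $f(x)+f(y)\ge f(\min(x,y))+f(\max(x,y))$ for all $x,y\in\mathbb{R}^2_{\ge0}$; (2) $f(0)=0$; (3) $f$ is non-decreasing: $0\le x\le y$ implies $f(x)\le f(y)$; (4) it has the Diminishing Returns property: for every $x\ge0$, every $i$, every $\lambda>0$ and $\varepsilon>0$, with $y=x+\lambda e_i$, one has $f(x+\varepsilon e_i)-f(x)\ge f(y+\varepsilon e_i)-f(y)$.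 Left and right partial derivatives: $f^-_i(x)=\lim_{\varepsilon\to+0}\frac{f(x)-f(x-\varepsilon e_i)}{\varepsilon}$ (for $x_i>0$) and $f^+_i(x)=\lim_{\varepsilon\to+0}\frac{f(x+\varepsilon e_i)-f(x)}{\varepsilon}$; the value $+\infty$ is allowed for $f_i^+$ when $x_i=0$. Cost: $\mathrm{Cost}(f)=\max\{f^+_1(0),f^+_2(0)\}$, which may be $+\infty$. s-surface (in dimension 2): a smooth curve $S\subseteq\mathbb{R}^2_{\ge0}$ separating a downward closed set of (''unqualified'') points of $\mathbb{R}^2_{\ge0}$ containing the origin from the remaining (''qualified'') points, such that (a) $0\notin S$, (b) $S$ is compact, and (c) for every $p\in S$ (including the endpoints on the axes) the normal vector $\nabla S(p)$ of $S$ at $p$ pointing outwards (towards the qualified points) has strictly positive coordinates. (A set $D$ is downward closed if $x\in D$ and $0\le y\le x$ imply $y\in D$.) Feasibility: an EL function $f$ is $S$-feasible if $f^-_i(p)-f^+_i(p)\ge1$ for $i=1,2$ and all $p\in S$ with both coordinates strictly positive. $\mathrm{OPT}(S)$ is the infimum of $\mathrm{Cost}(f)$ over all $S$-feasible EL functions $f$ ($+\infty$ if there are none). *)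

(* Defs.v *)
From HB Require Import structures.
From mathcomp Require Import all_boot all_order all_algebra.
From mathcomp Require Import all_classical all_reals all_analysis.

Set Implicit Arguments.
Unset Strict Implicit.
Unset Printing Implicit Defensive.

Import Order.TTheory GRing.Theory Num.Theory.
Import numFieldNormedType.Exports.

Local Open Scope classical_set_scope.
Local Open Scope ring_scope.

(* Points of the plane are row vectors; the coordinates 1, 2 of the text are  *)
(* the indices 0, 1 of 'I_2. A function on the nonnegative quadrant is        *)
(* represented by a function on the whole plane: everything below looks only  *)
(* at its values on the quadrant.                                             *)
Section Plane.
Variable R : realType.
Implicit Types (x y p n : 'rV[R]_2) (f : 'rV[R]_2 -> R) (i : 'I_2).

Definition pt (s t : R) : 'rV[R]_2 := \row_i (if i == 0 then s else t).

Definition unitvec i : 'rV[R]_2 := delta_mx 0 i.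

Definition dot x y : R := \sum_i x 0 i * y 0 i.

Definition lev x y : Prop := forall i, x 0 i <= y 0 i.

Definition minv x y : 'rV[R]_2 := map2_mx Num.min x y.
Definition maxv x y : 'rV[R]_2 := map2_mx Num.max x y.

Definition quadrant : set 'rV[R]_2 := [set x | lev 0 x].

Definition downward_closed (D : set 'rV[R]_2) : Prop :=
  forall x y, D x -> lev 0 y -> lev y x -> D y.

Definition submodular f : Prop :=
  forall x y, lev 0 x -> lev 0 y -> f (minv x y) + f (maxv x y) <= f x + f y.

Definition nondecreasing f : Prop :=
  forall x y, lev 0 x -> lev x y -> f x <= f y.

Definition diminishing_returns f : Prop :=
  forall x i (l e : R), lev 0 x -> 0 < l -> 0 < e ->
    let y := x + l *: unitvec i in
    f (y + e *: unitvec i) - f y <= f (x + e *: unitvec i) - f x.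

Definition entropy_like f : Prop :=
  [/\ submodular f, f 0 = 0, nondecreasing f & diminishing_returns f].

(* One-sided partial derivatives, as limits in the extended reals. For an     *)
(* entropy-like f the difference quotients are monotone in e, so the limits   *)
(* exist; the left one is used only where p 0 i > 0.                          *)
Definition lderiv f i p : \bar R :=
  lim (((f p - f (p - e *: unitvec i)) / e)%:E @[e --> 0^'+]).
Definition rderiv f i p : \bar R :=
  lim (((f (p + e *: unitvec i) - f p) / e)%:E @[e --> 0^'+]).

Definition Cost f : \bar R := maxe (rderiv f 0 0) (rderiv f 1 0).

(* A compact smooth curve in parametric form: an injective C^1 curve with     *)
(* nonvanishing velocity on [0, 1]. A curve that is C^1 on [0, 1] with        *)
(* one-sided derivatives at the endpoints extends to a C^1 curve on R, so     *)
(* asking g to be C^1 on R is no restriction.                                 *)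
Definition smooth_param (g : R -> 'rV[R]_2) (S : set 'rV[R]_2) : Prop :=
  [/\ forall t : R, derivable g t 1,
      continuous (derive1 g),
      {in `[0, 1], forall t, derive1 g t != 0},
      {in `[0, 1] &, injective g} &
      S = g @` `[0, 1]].

Definition smooth_curve (S : set 'rV[R]_2) : Prop :=
  exists g, smooth_param g S.

Definition qualified (D : set 'rV[R]_2) : set 'rV[R]_2 := quadrant `\` D.

(* S is the common boundary of the unqualified set D and of the qualified     *)
(* set; the points of S themselves may belong to either side.                 *)
Definition separates (S D : set 'rV[R]_2) : Prop :=
  S = closure D `&` closure (qualified D).

Definition outward_unit_normal (S D : set 'rV[R]_2) p n : Prop :=
  [/\ dot n n = 1,
      exists (g : R -> 'rV[R]_2) (t : R),
        [/\ smooth_param g S, t \in `[0, 1], g t = p & dot n (derive1 g t) = 0] &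
      \forall e \near 0^'+, qualified D (p + e *: n)].

(* The default value 0 does not have positive coordinates, so condition (c)   *)
(* below includes the existence of the outward normal.                        *)
Definition outward_normal (S D : set 'rV[R]_2) p : 'rV[R]_2 :=
  xget 0 [set n | outward_unit_normal S D p n].

(* S is an s-surface whose set of unqualified points is D. *)
Record s_surface (S D : set 'rV[R]_2) : Prop := SSurface {
  s_surface_quadrant : S `<=` quadrant;
  s_surface_smooth : smooth_curve S;
  s_surface_unqualified : D `<=` quadrant;
  s_surface_down : downward_closed D;
  s_surface_origin : D 0;
  s_surface_separates : separates S D;
  s_surface_notin0 : ~ S 0;
  s_surface_compact : compact S;
  s_surface_normal : forall p, S p -> forall i, 0 < outward_normal S D p 0 i }.

Definition interior_pt p : Prop := forall i, 0 < p 0 i.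

Definition feasible (S : set 'rV[R]_2) f : Prop :=
  forall p i, S p -> interior_pt p -> (1 <= lderiv f i p - rderiv f i p)%E.

Definition OPT (S : set 'rV[R]_2) : \bar R :=
  ereal_inf [set Cost f | f in [set f | entropy_like f /\ feasible S f]].

Definition strictly_decreasing_on (A : set R) (h : R -> R) : Prop :=
  forall x y : R, A x -> A y -> x < y -> h y < h x.

Definition strictly_convex_on (A : set R) (h : R -> R) : Prop :=
  forall x y t : R, A x -> A y -> x != y -> 0 < t < 1 ->
    h (t * x + (1 - t) * y) < t * h x + (1 - t) * h y.

Definition strictly_concave_on (A : set R) (h : R -> R) : Prop :=
  strictly_convex_on A (fun x : R => - h x).

End Plane.

(* Main.v *)
Require Import Defs.
From mathcomp Require Import all_boot all_order all_algebra.
From mathcomp Require Import all_classical all_reals all_analysis.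
From mathcomp Require Import ring lra.

Set Implicit Arguments.
Unset Strict Implicit.
Unset Printing Implicit Defensive.

Import Order.TTheory GRing.Theory Num.Theory.
Import numFieldNormedType.Exports.

Local Open Scope classical_set_scope.
Local Open Scope ring_scope.

(** At an interior point p of S write n for the outward normal.

    Lower bound. Across S an entropy-like function has a gradient jump, and
    continuity forces this jump to be normal to S. If its second component is
    at least 1, its first is therefore at least n_1 / n_2, and submodularity and
    diminishing returns carry this slope back to the origin. The rigorous
    version (kink_decay, secant_slope_le) needs no differentiability of the
    function: if the cost M were below the slope c of the secants of S on a
    whole interval, the right slope of f(x, .) at the point of S above x would
    grow by at least 1 - M / c between any two abscissas, and no real number
    exceeds all multiples of 1 - M / c. Convexity or concavity provides such an
    interval on one side of p with c = n_1 / n_2 (normal_ratio_le), once the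
    line orthogonal to n at p is known to support S (normal_supports).

    Upper bound. Let W >= 1 bound all the ratios, and let S be convex. Clamp the
    slope of -alpha from below at 1: this gives a concave function h1 with
    slopes in [1, W]. Do the same with beta to get h2. If S has slope -c at
    (x, alpha x), then h1 has slope max(c, 1) at x and h2 has slope
    max(1, 1 / c) at alpha x, so h1 x + h2 (alpha x) is constant along S, with
    value T (clamped_sum). Up to a constant the function min (h1 x + h2 y, T) is
    entropy-like with cost at most W, and it passes on S from slopes at least 1
    to slope 0. If S is concave, the point reflection of S is convex; the same
    functions precomposed with the reflection are concave with slopes in
    [-W, -1], and W (x + y) + min (h1 x + h2 y, T) has the required properties.
    A sign sigma, 1 for convex and -1 for concave S, treats both cases at once.

    Clamping is written as a supremal convolution (clamped), which needs
    neither integrals nor the point where the slope of S crosses -1. *)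

(** * Concave slices and one-sided derivatives *)

(** The one-variable functions obtained from an entropy-like function by fixing
    one coordinate. *)
Definition slice (R : realType) (phi : R -> R) : Prop :=
  (forall x y, 0 <= x -> x <= y -> phi x <= phi y) /\
  (forall x l e, 0 <= x -> 0 < l -> 0 < e ->
     phi (x + l + e) - phi (x + l) <= phi (x + e) - phi x).

Lemma archimedean_le0 (R : realType) (u v : R) :
  (forall n, n%:R * u <= v) -> u <= 0.
Proof.
move=> nuv; rewrite leNgt; apply/negP => u0.
have v0 : 0 <= v by have := nuv 0%N; rewrite mul0r.
have /archi_boundP : 0 <= v / u by rewrite divr_ge0// ltW.
by rewrite ltr_pdivrMr// ltNge nuv.
Qed.

(** On a grid the increments of a slice decrease, so their averages do too. *)
Lemma slice_grid (R : realType) (phi : R -> R) (x h : R) (n m : nat) :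
  slice phi -> 0 <= x -> 0 < h -> (n <= m)%N ->
  n%:R * (phi (x + m%:R * h) - phi x) <= m%:R * (phi (x + n%:R * h) - phi x).
Proof.
move=> [phi_mono phi_dr] x0 h0.
pose D k := phi (x + k%:R * h) - phi x.
have DS k : D k.+1 = D k + (D k.+1 - D k) by ring.
have D0 : D 0%N = 0 by rewrite /D mul0r addr0 subrr.
have inc k : D k.+2 - D k.+1 <= D k.+1 - D k.
  have kh0 : 0 <= x + k%:R * h by rewrite addr_ge0// mulr_ge0// ltW.
  have := phi_dr _ _ _ kh0 h0 h0; rewrite /D -!natr1 !mulrDl !mul1r.
  by rewrite !addrA; lra.
have incn k j : D (j + k).+1 - D (j + k)%N <= D k.+1 - D k.
  by elim: j => [|j IH]; [rewrite add0n|exact: le_trans (inc _) IH].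
have lowD k j : (k <= j)%N -> k%:R * (D j.+1 - D j) <= D k.
  elim: k => [|k IH] kj; first by rewrite mul0r D0.
  rewrite -natr1 mulrDl mul1r [leRHS]DS lerD ?IH ?(ltnW kj)//.
  by have := incn k (j - k)%N; rewrite subnK// ltnW.
move=> nm; rewrite -/(D m) -/(D n) -(subnK nm).
elim: (m - n)%N => [|j IH]; first by rewrite add0n.
have := lowD n (j + n)%N (leq_addl _ _).
rewrite addSn -natr1 mulrDl mul1r => ?; lra.
Qed.

(** A monotone function with diminishing increments is concave: e' is rounded up
    to the grid of mesh e / n, which monotony permits, and n goes to infinity. *)
Lemma slice_chord (R : realType) (phi : R -> R) (x e e' : R) :
  slice phi -> 0 <= x -> 0 < e -> e <= e' ->
  e * (phi (x + e') - phi x) <= e' * (phi (x + e) - phi x).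
Proof.
move=> phi_slice x0 e0 ee'; rewrite -subr_le0.
apply: (@archimedean_le0 _ _ (e * (phi (x + e) - phi x))) => -[|n].
  rewrite mul0r mulr_ge0 ?(ltW e0)// subr_ge0; apply phi_slice.1 => //.
  by rewrite lerDl ltW.
have n0 : 0 < n.+1%:R :> R by rewrite ltr0n.
pose h := e / n.+1%:R.
have h0 : 0 < h by rewrite divr_gt0.
have nh : n.+1%:R * h = e by rewrite mulrC divfK// gt_eqF.
have e'h0 : 0 <= e' / h by rewrite divr_ge0 ?ltW// (lt_le_trans e0).
have /andP[tl tu] := truncn_itv e'h0; set m := Num.truncn _ in tl tu.
have mh : e' <= m.+1%:R * h by rewrite -ler_pdivrMr// ltW.
have mh' : m%:R * h <= e' by rewrite -ler_pdivlMr.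
have nm : (n.+1 <= m.+1)%N.
  by rewrite -(ler_nat R) -(ler_pM2r h0) nh (le_trans ee').
have := slice_grid phi_slice x0 h0 nm; rewrite nh => grid.
have up : phi (x + e') <= phi (x + m.+1%:R * h).
  apply phi_slice.1; rewrite ?lerD2l// addr_ge0//.
  exact: le_trans (ltW e0) ee'.
have dphi0 : 0 <= phi (x + e) - phi x.
  by rewrite subr_ge0; apply phi_slice.1; rewrite // lerDl ltW.
have s1 : n.+1%:R * (phi (x + e') - phi x) <= m.+1%:R * (phi (x + e) - phi x).
  by apply: le_trans grid; rewrite ler_pM2l// lerD2r.
have s2 : e * m.+1%:R <= n.+1%:R * e' + e.
  rewrite -natr1 mulrDr mulr1 lerD2r -nh -mulrA ler_pM2l// mulrC//.
have := ler_wpM2r dphi0 s2; have := ler_wpM2l (ltW e0) s1; lra.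
Qed.

(** For a slice the difference quotients are monotone in the step, so the
    one-sided derivatives are a supremum and an infimum of quotients; comparing
    them with a real number is a family of inequalities without limits. *)
Lemma right_derivative_le (R : realType) (phi : R -> R) (x M : R) :
  slice phi -> 0 <= x ->
  (lim (((phi (x + e) - phi x) / e)%:E @[e --> 0^'+]) <= M%:E)%E <->
  (forall e, 0 < e -> phi (x + e) - phi x <= e * M).
Proof.
move=> phi_slice x0.
have lims : ((phi (x + e) - phi x) / e)%:E @[e --> 0^'+] -->
    ereal_sup ((fun e => ((phi (x + e) - phi x) / e)%:E) @` `]0, +oo[).
  apply: (@nonincreasing_at_right_cvge _ _ _ +oo%O) => // e e'.
  rewrite !in_itv/= !andbT => e0 e'0 ee'; rewrite lee_fin.
  rewrite ler_pdivrMr// mulrAC ler_pdivlMr// mulrC [leRHS]mulrC.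
  exact: slice_chord.
rewrite (cvg_lim _ lims)//.
split=> [supM e e0|phiM].
  rewrite mulrC -ler_pdivrMr// -lee_fin; apply: le_trans supM.
  by apply: ereal_sup_ubound; exists e => //=; rewrite in_itv/= e0.
apply: ge_ereal_sup => q [e /=]; rewrite in_itv/= andbT => e0 <-.
by rewrite lee_fin ler_pdivrMr// mulrC phiM.
Qed.

Lemma left_derivative_ge (R : realType) (phi : R -> R) (x M : R) :
  slice phi -> 0 < x ->
  (M%:E <= lim (((phi x - phi (x - e)) / e)%:E @[e --> 0^'+]))%E <->
  (forall e, 0 < e <= x -> e * M <= phi x - phi (x - e)).
Proof.
move=> phi_slice x0.
have lims : ((phi x - phi (x - e)) / e)%:E @[e --> 0^'+] -->
    ereal_inf ((fun e => ((phi x - phi (x - e)) / e)%:E) @` `]0, x]).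
  apply: (@nondecreasing_at_right_cvge _ _ _ (BRight x)) => //.
  move=> e e'; rewrite !in_itv/= => /andP[e0 ex] /andP[e'0 e'x] ee'.
  rewrite lee_fin ler_pdivrMr// mulrAC ler_pdivlMr//.
  have [->//|ne] := eqVneq e e'.
  have ltee' : e < e' by rewrite lt_neqAle ne.
  have le' : e' - e <= e' by lra.
  have := @slice_chord _ phi (x - e') (e' - e) e' phi_slice.
  rewrite !subr_ge0 subr_gt0 => /(_ e'x ltee' le').
  by rewrite subrK addrA subrK; lra.
rewrite (cvg_lim _ lims)//.
split=> [Minf e /andP[e0 ex]|phiM].
  rewrite mulrC -ler_pdivlMr// -lee_fin; apply: le_trans Minf _.
  by apply: ereal_inf_lbound; exists e => //=; rewrite in_itv/= e0.
apply: le_ereal_inf_tmp => q [e /=]; rewrite in_itv/= => e0x <-.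
have /andP[e0 _] := e0x.
by rewrite lee_fin ler_pdivlMr// mulrC phiM.
Qed.

(** A drop of the slope by at least 1, with real bounds gm and gp for the left and
    right slopes in place of limits. *)
Definition kink (R : realType) (phi : R -> R) (x : R) : Prop :=
  exists gm gp, [/\ 1 <= gm - gp,
    forall e, 0 < e <= x -> e * gm <= phi x - phi (x - e) &
    forall e, 0 < e -> phi (x + e) - phi x <= e * gp].

(** Monotony keeps both one-sided derivatives nonnegative and the chord from 0
    keeps the left one finite, so that a difference at least 1 of the extended
    derivatives is a difference of reals. *)
Lemma kinkP (R : realType) (phi : R -> R) (x : R) :
  slice phi -> 0 < x ->
  (1 <= lim (((phi x - phi (x - e)) / e)%:E @[e --> 0^'+]) -
        lim (((phi (x + e) - phi x) / e)%:E @[e --> 0^'+]))%E <-> kink phi x.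
Proof.
move=> phi_slice x0.
have L M := left_derivative_ge M phi_slice x0.
have U M := right_derivative_le M phi_slice (ltW x0).
set l := lim _ in L *; set r := lim _ in U *.
split=> [|[gm [gp [g1 /L gml /U rgp]]]]; last first.
  apply: (@le_trans _ _ (gm - gp)%:E); first by rewrite lee_fin.
  by rewrite EFinB; apply: leeB.
have lx : (l <= ((phi x - phi 0) / x)%:E)%E.
  rewrite leNgt; apply/negP => lgt.
  have [M /andP[lM Ml]] : exists M, (((phi x - phi 0) / x) < M) && (M%:E <= l)%E.
    case: l lgt {L} => [s| |]//.
      by rewrite lte_fin => sgt; exists s; rewrite sgt/=.
    by move=> _; exists ((phi x - phi 0) / x + 1); rewrite leey andbT; lra.
  have /L/(_ x) := Ml; rewrite x0 lexx subrr => /(_ isT).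
  by move: lM; rewrite ltr_pdivrMr// mulrC; lra.
have r0 : (0 <= r)%E.
  rewrite leNgt; apply/negP => rlt.
  have [M /andP[rM Mr]] : exists M, (M < 0) && (r <= M%:E)%E.
    case: r rlt {U} => [s| |]//.
      by rewrite lte_fin => slt; exists s; rewrite slt/=.
    by move=> _; exists (- 1); rewrite leNye andbT; lra.
  have /U/(_ 1 ltr01) := Mr; rewrite mul1r.
  have : phi x <= phi (x + 1) by apply phi_slice.1; [exact: ltW|lra].
  by lra.
case: l L lx => [gm| |] // L lx; case: r U r0 => [gp| |] // U r0.
rewrite -EFinB lee_fin => g1; exists gm, gp; split=> //.
- by apply/L.
- by apply/U.
Qed.

(** * Entropy-like functions in coordinates *)

(** Entropy-like functions of two real variables. Submodularity only has to be
    stated for crossing pairs, as it is an equality for comparable points. *)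
Record el_fun (R : realType) (F : R -> R -> R) : Prop := ElFun {
  el_zero : F 0 0 = 0;
  el_mono : forall x x' y y', 0 <= x -> x <= x' -> 0 <= y -> y <= y' ->
    F x y <= F x' y';
  el_submod : forall x x' y y', 0 <= x -> x <= x' -> 0 <= y -> y <= y' ->
    F x y + F x' y' <= F x y' + F x' y;
  el_dr1 : forall x y l e, 0 <= x -> 0 <= y -> 0 < l -> 0 < e ->
    F (x + l + e) y - F (x + l) y <= F (x + e) y - F x y;
  el_dr2 : forall x y l e, 0 <= x -> 0 <= y -> 0 < l -> 0 < e ->
    F x (y + l + e) - F x (y + l) <= F x (y + e) - F x y }.

Lemma el_fun_swap (R : realType) (F : R -> R -> R) :
  el_fun F -> el_fun (fun x y => F y x).
Proof.
case=> F0 Fmono Fsub dr1 dr2; split=> //.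
- by move=> x x' y y' x0 xx' y0 yy'; exact: Fmono.
- move=> x x' y y' x0 xx' y0 yy'.
  by have := Fsub y y' x x' y0 yy' x0 xx'; lra.
- by move=> x y l e x0 y0; exact: dr2.
- by move=> x y l e x0 y0; exact: dr1.
Qed.

Lemma el_slice1 (R : realType) (F : R -> R -> R) (y : R) :
  el_fun F -> 0 <= y -> slice (fun x => F x y).
Proof.
move=> elF y0; split=> [x x' x0 xx'|x l e x0 l0 e0].
  exact: el_mono elF _ _ _ _ _ _ _ _.
exact: el_dr1 elF _ _ _ _ _ _ _ _.
Qed.

Lemma el_slice2 (R : realType) (F : R -> R -> R) (x : R) :
  el_fun F -> 0 <= x -> slice (F x).
Proof. by move=> /el_fun_swap /el_slice1; apply. Qed.

Lemma ord2P (i : 'I_2) : i = 0 \/ i = 1.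
Proof.
case: i => [[|[|//]]] ?; [left|right]; exact: val_inj.
Qed.

Lemma pt0 (R : realType) (s t : R) : pt s t 0 0 = s.
Proof. by rewrite mxE. Qed.

Lemma pt1 (R : realType) (s t : R) : pt s t 0 1 = t.
Proof. by rewrite mxE. Qed.

Lemma pt_coords (R : realType) (v : 'rV[R]_2) : pt (v 0 0) (v 0 1) = v.
Proof. by apply/rowP => i; case: (ord2P i) => ->; rewrite ?pt0 ?pt1. Qed.

Lemma pt_zero (R : realType) : pt 0 0 = 0 :> 'rV[R]_2.
Proof. by apply/rowP => i; rewrite !mxE if_same. Qed.

Lemma pt_unitvec0 (R : realType) (s t e : R) :
  pt s t + e *: unitvec R 0 = pt (s + e) t.
Proof.
by apply/rowP => i; case: (ord2P i) => ->; rewrite !mxE//= ?mulr1 ?mulr0 ?addr0.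
Qed.

Lemma pt_unitvec1 (R : realType) (s t e : R) :
  pt s t + e *: unitvec R 1 = pt s (t + e).
Proof.
by apply/rowP => i; case: (ord2P i) => ->; rewrite !mxE//= ?mulr1 ?mulr0 ?addr0.
Qed.

Lemma lev_pt (R : realType) (s t s' t' : R) :
  lev (pt s t) (pt s' t') <-> s <= s' /\ t <= t'.
Proof.
split=> [le_pt|[ss' tt'] i].
  by have := le_pt 0; have := le_pt 1; rewrite !pt0 !pt1.
by case: (ord2P i) => ->; rewrite ?pt0 ?pt1.
Qed.

Lemma minv_pt (R : realType) (s t s' t' : R) :
  minv (pt s t) (pt s' t') = pt (Num.min s s') (Num.min t t').
Proof. by apply/rowP => i; case: (ord2P i) => ->; rewrite !mxE. Qed.

Lemma maxv_pt (R : realType) (s t s' t' : R) :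
  maxv (pt s t) (pt s' t') = pt (Num.max s s') (Num.max t t').
Proof. by apply/rowP => i; case: (ord2P i) => ->; rewrite !mxE. Qed.

Lemma entropy_like_curry (R : realType) (f : 'rV[R]_2 -> R) :
  entropy_like f <-> el_fun (fun x y => f (pt x y)).
Proof.
have lev0 (v : 'rV[R]_2) : lev 0 v <-> 0 <= v 0 0 /\ 0 <= v 0 1.
  by rewrite -[v in lev _ v]pt_coords -pt_zero; exact: lev_pt.
split=> [[sub f0 mono dr]|[f0 mono sub dr1 dr2]]; split.
- by rewrite pt_zero.
- move=> x x' y y' x0 xx' y0 yy'; apply: mono; last exact/lev_pt.
  by apply/lev0; rewrite pt0 pt1.
- move=> x x' y y' x0 xx' y0 yy'.
  have := sub (pt x y') (pt x' y); rewrite minv_pt maxv_pt.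
  rewrite (min_idPl xx') (min_idPr yy') (max_idPr xx') (max_idPl yy').
  apply; apply/lev0; rewrite pt0 pt1; split=> //; first exact: le_trans yy'.
  exact: le_trans xx'.
- move=> x y l e x0 y0 l0 e0.
  have /= := dr (pt x y) 0 l e; rewrite !pt_unitvec0; apply=> //.
  by apply/lev0; rewrite pt0 pt1.
- move=> x y l e x0 y0 l0 e0.
  have /= := dr (pt x y) 1 l e; rewrite !pt_unitvec1; apply=> //.
  by apply/lev0; rewrite pt0 pt1.
- move=> v w; rewrite -(pt_coords v) -(pt_coords w) -pt_zero !lev_pt.
  set x := v 0 0; set y := v 0 1; set x' := w 0 0; set y' := w 0 1.
  move=> [x0 y0] [x'0 y'0]; rewrite minv_pt maxv_pt.
  case: (leP x x') => xx'; case: (leP y y') => yy' //.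
  + by rewrite [leRHS]addrC; have := sub x x' y' y x0 xx' y'0 (ltW yy'); lra.
  + by have := sub x' x y y' x'0 (ltW xx') y0 yy'; lra.
  + lra.
- by rewrite -pt_zero.
- move=> v w; rewrite -(pt_coords v) -(pt_coords w) -pt_zero !lev_pt.
  by move=> [x0 y0] [xx' yy']; exact: mono.
- move=> v i l e; rewrite -(pt_coords v) -pt_zero lev_pt => -[x0 y0] l0 e0.
  case: (ord2P i) => -> /=; rewrite ?pt_unitvec0 ?pt_unitvec1.
    exact: dr1.
  exact: dr2.
Qed.

Lemma feasible_kinks (R : realType) (S : set 'rV[R]_2) (f : 'rV[R]_2 -> R) :
  entropy_like f ->
  feasible S f <-> forall x y, S (pt x y) -> 0 < x -> 0 < y ->
    kink (fun s => f (pt s y)) x /\ kink (fun t => f (pt x t)) y.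
Proof.
move=> /entropy_like_curry elf.
have d0 (x y : R) : 0 < x -> 0 < y ->
    (1 <= lderiv f 0%R (pt x y) - rderiv f 0%R (pt x y))%E <->
    kink (fun s => f (pt s y)) x.
  move=> x0 y0; rewrite -kinkP//; last exact: el_slice1 elf (ltW y0).
  rewrite /lderiv /rderiv.
  under eq_fun do rewrite -scaleNr pt_unitvec0.
  by under [in X in (_ - X)%E]eq_fun do rewrite pt_unitvec0.
have d1 (x y : R) : 0 < x -> 0 < y ->
    (1 <= lderiv f 1%R (pt x y) - rderiv f 1%R (pt x y))%E <->
    kink (fun t => f (pt x t)) y.
  move=> x0 y0; rewrite -kinkP//; last exact: el_slice2 elf (ltW x0).
  rewrite /lderiv /rderiv.
  under eq_fun do rewrite -scaleNr pt_unitvec1.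
  by under [in X in (_ - X)%E]eq_fun do rewrite pt_unitvec1.
split=> [feas x y Sxy x0 y0|kinks p i].
  have int : interior_pt (pt x y).
    by move=> i; case: (ord2P i) => ->; rewrite ?pt0 ?pt1.
  by split; [apply/d0|apply/d1] => //; exact: feas.
rewrite -(pt_coords p) => Sp int.
have [x0 y0] : 0 < p 0 0 /\ 0 < p 0 1.
  by have := int 0; have := int 1; rewrite pt0 pt1.
have [k0 k1] := kinks _ _ Sp x0 y0.
by case: (ord2P i) => ->; [apply/d0|apply/d1].
Qed.

Lemma Cost_le (R : realType) (f : 'rV[R]_2 -> R) (M : R) :
  entropy_like f -> (Cost f <= M%:E)%E <->
  forall h, 0 < h -> f (pt h 0) <= h * M /\ f (pt 0 h) <= h * M.
Proof.
move=> /entropy_like_curry elf.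
have f0 : f (pt 0 0) = 0 by exact: el_zero elf.
have d0 : (rderiv f 0%R 0%R <= M%:E)%E <-> forall h, 0 < h -> f (pt h 0) <= h * M.
  have := right_derivative_le M (el_slice1 elf (lexx 0)) (lexx 0).
  rewrite /rderiv -pt_zero.
  under eq_fun do rewrite -[X in (f X - _) / _](pt_unitvec0 0 0).
  by under [in X in _ <-> X]eq_forall do rewrite f0 subr0 add0r.
have d1 : (rderiv f 1%R 0%R <= M%:E)%E <-> forall h, 0 < h -> f (pt 0 h) <= h * M.
  have := right_derivative_le M (el_slice2 elf (lexx 0)) (lexx 0).
  rewrite /rderiv -pt_zero.
  under eq_fun do rewrite -[X in (f X - _) / _](pt_unitvec1 0 0).
  by under [in X in _ <-> X]eq_forall do rewrite f0 subr0 add0r.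
rewrite /Cost ge_max; split=> [/andP[/d0 h0 /d1 h1] h hpos|H].
  by split; [exact: h0|exact: h1].
by apply/andP; split; [apply/d0|apply/d1] => h /H[].
Qed.

(** * Slopes across a steep arc *)

(** The points (u, v) and (u', v') on the curve are opposite corners of a
    rectangle of height k = v - v'. Along its left side F grows by at least
    k gm, along its right side by at most k gp'. By submodularity and
    diminishing returns these growths differ by at most M (u' - u), which is at
    most M k / c. *)
Lemma kink_decay (R : realType) (F : R -> R -> R) (c M u u' v v' gm gp' : R) :
  el_fun F -> (forall h, 0 < h -> F h 0 <= h * M) -> 0 < c ->
  0 <= u -> u < u' -> 0 <= v' -> c * (u' - u) <= v - v' ->
  (forall e, 0 < e <= v -> e * gm <= F u v - F u (v - e)) ->
  (forall e, 0 < e -> F u' (v' + e) - F u' v' <= e * gp') ->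
  c * (gm - gp') <= M.
Proof.
move=> elF FM c0 u0 uu' v'0 secant gmP gpP.
have du0 : 0 < u' - u by rewrite subr_gt0.
have k0 : 0 < v - v' by apply: lt_le_trans secant; rewrite mulr_gt0.
have M0 : 0 <= M.
  have := FM 1 ltr01; have := el_mono elF (lexx 0) ler01 (lexx 0) (lexx 0).
  by rewrite (el_zero elF); lra.
have kv : v - v' <= v by lra.
have vv' : v' <= v by lra.
have := gmP (v - v'); rewrite k0 kv => /(_ isT).
rewrite opprB addrCA subrr addr0.
have := gpP (v - v') k0; rewrite addrCA subrr addr0.
have := el_mono elF u0 (ltW uu') (le_trans v'0 vv') (lexx v).
have := el_submod elF u0 (ltW uu') (lexx 0) v'0.
have low : F u' 0 - F u 0 <= (u' - u) * M.
  have F0 := el_zero elF; have := FM _ du0.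
  have [<-|u_neq0] := eqVneq 0 u; first by rewrite F0 !subr0.
  have u_gt0 : 0 < u by rewrite lt_neqAle u_neq0.
  have := el_dr1 elF (lexx 0) (lexx 0) u_gt0 du0.
  by rewrite !add0r subrKC F0; lra.
move=> sub mono up down.
have kg : (v - v') * (gm - gp') <= (u' - u) * M by lra.
have [g0|g0] := leP (gm - gp') 0.
  by apply: le_trans M0; rewrite pmulr_rle0.
rewrite -(ler_pM2l du0); apply: le_trans kg.
by rewrite mulrCA mulrA ler_pM2r.
Qed.

(** If c exceeded M, the right slope of F across the curve would increase by at
    least 1 - M / c > 0 between any two of its points. As infinitely many
    points precede the last one, this slope would be infinite there. *)
Lemma secant_slope_le (R : realType) (F : R -> R -> R) (alpha : R -> R)
    (x1 x2 c M : R) :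
  el_fun F -> (forall h, 0 < h -> F h 0 <= h * M) -> 0 < c ->
  0 <= x1 -> x1 < x2 -> (forall x, x1 <= x <= x2 -> 0 <= alpha x) ->
  (forall u v, x1 <= u -> u < v -> v <= x2 ->
     c * (v - u) <= alpha u - alpha v) ->
  (forall x, x1 <= x <= x2 -> kink (F x) (alpha x)) ->
  c <= M.
Proof.
move=> elF FM c0 x10 x12 alpha0 secants kinks; rewrite leNgt; apply/negP => Mc.
have grow n x gm gp : x1 < x <= x2 -> 1 <= gm - gp ->
    (forall e, 0 < e <= alpha x -> e * gm <= F x (alpha x) - F x (alpha x - e)) ->
    (forall e, 0 < e -> F x (alpha x + e) - F x (alpha x) <= e * gp) ->
    n%:R * (c - M) <= c * gp.
  elim: n x gm gp => [|n IH] x gm gp /andP[x1x xx2] g1 gmP gpP.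
    rewrite mul0r mulr_ge0// ?(ltW c0)//.
    have ax : 0 <= alpha x by rewrite alpha0// ltW.
    have ax1 : alpha x <= alpha x + 1 by lra.
    have := el_mono elF (le_trans x10 (ltW x1x)) (lexx x) ax ax1.
    by have := gpP 1 ltr01; lra.
  have [x1u ux] : x1 < (x1 + x) / 2 /\ (x1 + x) / 2 < x by lra.
  set u := (x1 + x) / 2 in x1u ux.
  have x1ux2 : x1 <= u <= x2 by lra.
  have x1ux2' : x1 < u <= x2 by lra.
  have [hm [hp [h1 hmP hpP]]] := kinks _ x1ux2.
  have := IH _ _ _ x1ux2' h1 hmP hpP.
  have u0 : 0 <= u by lra.
  have ax : 0 <= alpha x by rewrite alpha0// ltW.
  have := kink_decay elF FM c0 u0 ux ax (secants _ _ (ltW x1u) ux xx2) hmP gpP.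
  have := ler_wpM2l (ltW c0) h1; rewrite -natr1 mulrDl mul1r; lra.
have x2x2 : x1 <= x2 <= x2 by rewrite lexx ltW.
have x2x2' : x1 < x2 <= x2 by rewrite lexx x12.
have [gm [gp [g1 gmP gpP]]] := kinks _ x2x2.
have := archimedean_le0 (fun n => grow n _ _ _ x2x2' g1 gmP gpP); lra.
Qed.

(** * Supporting lines from normals *)

Definition jensen (R : realType) (a : R) (h : R -> R) : Prop :=
  forall x y t, 0 <= x <= a -> 0 <= y <= a -> 0 < t < 1 ->
    h (t * x + (1 - t) * y) <= t * h x + (1 - t) * h y.

Lemma derivative_approx (R : realType) (f : R -> R) (t eta : R) :
  derivable f t 1 -> 0 < eta -> exists2 r : R, 0 < r &
    forall h : R, `|h| < r -> `|f (t + h) - f t - h * 'D_1 f t| <= eta * `|h|.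
Proof.
move=> /derivableP[/cvg_ex[/= l fl] fE] eta0.
have {fE}-> : 'D_1 f t = l by exact/cvg_lim.
move/cvgrPdist_le : fl => /(_ _ eta0)[/= r r0] fr; exists r => // h hr.
have [->|h0] := eqVneq h 0; first by rewrite addr0 subrr mul0r subrr normr0 mulr0.
have := fr h; rewrite /= sub0r normrN => /(_ hr h0).
rewrite /GRing.scale/= mulr1 (addrC h) => fh.
have -> : f (t + h) - f t - h * l = - (h * (l - h^-1 * (f (t + h) - f t))).
  by field.
by rewrite normrN normrM mulrC ler_pM2r ?normr_gt0.
Qed.

(** A convex graph stays above the line through one of its points whose slope
    is that of a differentiable parametrisation there: a value G below the line
    at v would push the graph below it by a fixed fraction of the horizontal
    distance all the way from g1 t to v, whereas the parametrisation leaves the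
    line to first order only. *)
Lemma tangent_below_convex (R : realType) (kappa g1 g2 : R -> R)
    (a t m v : R) :
  jensen a kappa -> 0 < t < 1 ->
  (forall s, 0 <= s <= 1 -> 0 <= g1 s <= a /\ g2 s = kappa (g1 s)) ->
  derivable g1 t 1 -> derivable g2 t 1 ->
  'D_1 g1 t != 0 -> 'D_1 g2 t = m * 'D_1 g1 t -> 0 <= v <= a ->
  kappa (g1 t) + m * (v - g1 t) <= kappa v.
Proof.
move=> conv /andP[t0 t1] onK dg1 dg2; set d := 'D_1 g1 t => d0 g2d va.
rewrite leNgt; apply/negP => below.
have [xa _] : 0 <= g1 t <= a /\ g2 t = kappa (g1 t) by apply: onK; rewrite !ltW.
set x := g1 t in below xa; set w := v - x in below.
have w0 : w != 0.
  by apply: contraTneq below => w0; move/subr0_eq : (w0) => ->; rewrite w0; lra.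
have [G [G0 GE]] : exists G, 0 < G /\ kappa v = kappa x + m * w - G.
  by exists (kappa x + m * w - kappa v); split; lra.
have D0 : 0 < `|d| by rewrite normr_gt0.
have W0 : 0 < `|w| by rewrite normr_gt0.
have M0 : 0 < `|m| + 1 by rewrite ltr_wpDl.
pose eta := Num.min (`|d| / 2) (G * `|d| / (4 * (`|m| + 1) * `|w|)).
have eta0 : 0 < eta by rewrite lt_min !divr_gt0 ?mulr_gt0.
have [r1 r10 g1r] := derivative_approx dg1 eta0.
have [r2 r20 g2r] := derivative_approx dg2 eta0.
(* The parameter step h moves g1 by about the fraction rho of the way from x
   to v. *)
pose rr := Num.min (Num.min r1 r2) (Num.min t (1 - t)).
have rr0 : 0 < rr by rewrite !lt_min r10 r20 t0 subr_gt0.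
pose rho := Num.min (1 / 4) (rr / 2 * (`|d| / `|w|)).
have rho0 : 0 < rho by rewrite lt_min !mulr_gt0 ?invr_gt0//; lra.
pose h := rho * (w / d).
have hE : `|h| = rho * (`|w| / `|d|).
  by rewrite normrM normf_div gtr0_norm.
have hrr : `|h| < rr.
  have : rho <= rr / 2 * (`|d| / `|w|) by rewrite ge_min lexx orbT.
  rewrite -ler_pdivrMr ?divr_gt0// invf_div -hE; lra.
have [hr1 hr2 ht ht1] : [/\ `|h| < r1, `|h| < r2, `|h| < t & `|h| < 1 - t].
  by move: hrr; rewrite !lt_min => /andP[/andP[-> ->] /andP[-> ->]].
have th : 0 <= t + h <= 1.
  by move: ht ht1; rewrite !ltr_norml => /andP[? ?] /andP[? ?]; lra.
have [ua uE] := onK _ th; have [_ xE] := onK t (ltac:(lra)).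
have := g1r _ hr1; have := g2r _ hr2; rewrite uE xE -/x -/d g2d.
have hd : h * d = rho * w by rewrite /h -mulrA divfK.
rewrite mulrCA hd.
set e2 := kappa _ - _ - _ => e2h; set e1 := g1 (t + h) - x - _ => e1h.
have hpos : 0 <= `|h| by [].
have [etad etaG] : eta <= `|d| / 2 /\
    eta <= G * `|d| / (4 * (`|m| + 1) * `|w|).
  by rewrite !ge_min !lexx orbT.
pose tau := rho + e1 / w.
have e1w : `|e1 / w| <= rho / 2.
  rewrite normf_div ler_pdivrMr//; apply: le_trans e1h _.
  rewrite hE mulrCA; apply: le_trans (_ : rho * (`|d| / 2 * (`|w| / `|d|)) <= _).
    by rewrite ler_pM2l// ler_pM2r// divr_gt0.
  rewrite le_eqVlt; apply/orP; left; apply/eqP; field.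
  by rewrite gt_eqF.
have rho4 : rho <= 1 / 4 by rewrite ge_min lexx.
have [tau_low tau_up] : rho / 2 <= tau /\ tau <= 3 / 8.
  by move: e1w; rewrite /tau ler_norml => /andP[? ?]; lra.
have tau01 : 0 < tau < 1 by lra.
have uv : g1 (t + h) = tau * v + (1 - tau) * x.
  have -> : v = x + w by rewrite /w; ring.
  have : tau * w = rho * w + e1 by rewrite /tau mulrDl divfK.
  rewrite /e1; lra.
have := conv v x tau va xa tau01; rewrite -uv GE => Jk.
have tauw : tau * w = rho * w + e1 by rewrite /tau mulrDl divfK.
have key : tau * G <= (`|m| + 1) * (eta * `|h|).
  have -> : (`|m| + 1) * (eta * `|h|) = `|m| * (eta * `|h|) + eta * `|h| by ring.
  have me1 : m * e1 <= `|m| * (eta * `|h|).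
    apply: le_trans (ler_norm _) _; rewrite normrM.
    by rewrite ler_wpM2l.
  have : m * (tau * w) = m * (rho * w) + m * e1 by rewrite tauw; ring.
  have : - e2 <= eta * `|h| by apply: le_trans e2h; rewrite -normrN ler_norm.
  rewrite /e2; lra.
have : (`|m| + 1) * (eta * `|h|) <= rho * (G / 4).
  rewrite hE; apply: le_trans
    (_ : (`|m| + 1) * (G * `|d| / (4 * (`|m| + 1) * `|w|) * (rho * (`|w| / `|d|)))
         <= _).
    by rewrite ler_pM2l// ler_pM2r// mulr_gt0// divr_gt0.
  rewrite le_eqVlt; apply/orP; left; apply/eqP; field.
  by rewrite !gt_eqF.
have := ler_pM2r G0 (rho / 2) tau; rewrite tau_low => /idP.
have := mulr_gt0 rho0 G0; lra.
Qed.

(** By the intermediate value theorem an interior abscissa is taken strictly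
    between the parameters of the two ends of the arc, hence, by injectivity,
    only there. *)
Lemma interior_parameter (R : realType) (g1 : R -> R) (a s0 s1 t : R) :
  continuous g1 -> 0 <= s0 <= 1 -> 0 <= s1 <= 1 -> g1 s0 = 0 -> g1 s1 = a ->
  0 < g1 t < a -> 0 <= t <= 1 ->
  (forall s, 0 <= s <= 1 -> g1 s = g1 t -> s = t) -> 0 < t < 1.
Proof.
move=> cg1 s01 s11 g1s0 g1s1 /andP[x0 xa] t01 inj.
wlog s01le : g1 a s0 s1 t cg1 s01 s11 g1s0 g1s1 x0 xa t01 inj / s0 <= s1.
  move=> W; have [le01|/ltW le10] := leP s0 s1.
    exact: (W g1 a s0 s1 t).
  apply: (W (fun s => a - g1 s) a s1 s0 t) => //; rewrite ?g1s1 ?g1s0; try lra.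
  - by move=> s; apply: cvgB; [exact: cvg_cst|exact: cg1].
  - by move=> s s_itv gs; apply: inj => //; lra.
have [|c] := @IVT R g1 s0 s1 (g1 t) s01le (continuous_subspaceT cg1).
  rewrite g1s0 g1s1 ge_min le_max (ltW x0) (ltW xa) orbT//.
rewrite in_itv/= => /andP[s0c cs1] gc.
have ct : c = t by apply: inj => //; lra.
have s0t : s0 != t by apply: contraTneq x0 => <-; rewrite g1s0 ltxx.
have ts1 : t != s1 by apply: contraTneq xa => ->; rewrite g1s1 ltxx.
have : s0 < t by rewrite lt_neqAle s0t -ct.
have : t < s1 by rewrite lt_neqAle ts1 -ct.
lra.
Qed.

(** The line through p orthogonal to the normal is the tangent of the graph
    there, so it supports the graph from below if alpha is convex (sigma = 1)
    and from above if alpha is concave (sigma = -1). The positive normal excludes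
    a vertical tangent. *)
Lemma normal_supports (R : realType) (S D : set 'rV[R]_2) (a sigma : R)
    (alpha : R -> R) (p n : 'rV[R]_2) :
  S = [set pt x (alpha x) | x in `[0, a]] -> 0 < a ->
  jensen a (fun x => sigma * alpha x) ->
  S p -> 0 < p 0 0 < a -> 0 < n 0 0 -> 0 < n 0 1 ->
  outward_unit_normal S D p n -> forall q, S q ->
  0 <= sigma * (n 0 0 * (q 0 0 - p 0 0) + n 0 1 * (q 0 1 - p 0 1)).
Proof.
move=> SE a0 conv Sp pa n0 n1 [_ [g [t [[dg _ dg0 ginj Sg]]]]] + + + _ q Sq.
move=> t01 gtp ndot.
have onS s : 0 <= s <= 1 -> 0 <= g s 0 0 <= a /\ g s 0 1 = alpha (g s 0 0).
  move=> s01; have : S (g s) by rewrite Sg; exists s => //=; rewrite in_itv.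
  by rewrite SE => -[x /=]; rewrite in_itv/= => xa <-; rewrite pt0 pt1.
have t_itv : 0 <= t <= 1 by move: t01; rewrite in_itv.
have dgi i : derivable (fun s => g s 0 i) t 1.
  by have /derivable_mxP := dg t; exact.
have dgE i : derive1 g t 0 i = 'D_1 (fun s => g s 0 i) t.
  by rewrite derive1E derive_mx// mxE.
have endp x : 0 <= x <= a -> exists2 s, 0 <= s <= 1 & g s 0 0 = x.
  move=> xa; have : S (pt x (alpha x)) by rewrite SE; exists x => //=; rewrite in_itv.
  rewrite Sg => -[s /=]; rewrite in_itv/= => s01 gs.
  by exists s => //; rewrite gs pt0.
have [s0 s01 gs0] := endp 0 (ltac:(lra)).
have [s1 s11 gs1] := endp a (ltac:(lra)).
have tin : 0 < t < 1.
  apply: (@interior_parameter _ (fun s => g s 0 0) a s0 s1) => //.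
  - move=> s; apply: differentiable_continuous; apply/derivable1_diffP.
    by have /derivable_mxP := dg s; exact.
  - by rewrite gtp.
  - move=> s s_itv gs; apply: ginj; rewrite ?inE ?in_itv//.
    have [_ e1] := onS _ s_itv; have [_ e2] := onS _ t_itv.
    by rewrite -(pt_coords (g s)) -(pt_coords (g t)) e1 e2 gs.
have {}ndot : n 0 0 * 'D_1 (fun s => g s 0 0) t +
    n 0 1 * 'D_1 (fun s => g s 0 1) t = 0.
  rewrite -!dgE -ndot /dot !big_ord_recl big_ord0 addr0.
  by congr (_ + n 0 _ * derive1 g t 0 _); exact: val_inj.
have d0 : 'D_1 (fun s => g s 0 0) t != 0.
  apply: contraNneq (dg0 _ t01) => d0.
  apply/eqP/rowP => i; rewrite [RHS]mxE; case: (ord2P i) => ->.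
    by rewrite dgE.
  move: ndot; rewrite dgE d0 mulr0 add0r => /eqP.
  by rewrite mulf_eq0 gt_eqF//= => /eqP.
have d1 : 'D_1 (fun s => g s 0 1) t =
    - (n 0 0 / n 0 1) * 'D_1 (fun s => g s 0 0) t.
  move: ndot => /eqP; rewrite addr_eq0 => /eqP nd.
  by rewrite mulNr mulrAC nd; field; rewrite gt_eqF.
have [qa qE] : 0 <= q 0 0 <= a /\ q 0 1 = alpha (q 0 0).
  by move: Sq; rewrite SE => -[x /=]; rewrite in_itv/= => xa <-; rewrite pt0 pt1.
have pE : p 0 1 = alpha (p 0 0) by have [_] := onS _ t_itv; rewrite gtp.
have := @tangent_below_convex _ (fun x => sigma * alpha x) (fun s => g s 0 0)
  (fun s => sigma * g s 0 1) a t (- sigma * (n 0 0 / n 0 1)) (q 0 0) conv tin.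
rewrite gtp -pE -qE => supp.
have : sigma * p 0 1 + - sigma * (n 0 0 / n 0 1) * (q 0 0 - p 0 0) <=
    sigma * q 0 1.
  apply: supp => //.
  - by move=> s s_itv; have [ga gE] := onS _ s_itv; rewrite gE.
  - exact: derivableM.
  - rewrite deriveM// derive_cst [X in _ + X]scaler0 addr0 d1.
    by rewrite /GRing.scale/=; ring.
rewrite -subr_ge0 => supp'; have := mulr_ge0 (ltW n1) supp'.
congr (_ <= _); field; exact: lt0r_neq0.
Qed.

(** * Clamping the slope of a convex arc *)

(** The graph of a decreasing convex function whose slopes lie between -W and
    -1 / W. A set of pairs with conditions symmetric in the coordinates
    describes the function and its inverse simultaneously. *)
Record convex_arc (R : realType) (W : R) (P : set (R * R)) : Prop := ConvexArc {
  arc_nonempty : P !=set0;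
  arc_bounded : exists K, forall p, P p -> K <= p.1 /\ K <= p.2;
  arc_antitone1 : forall p q, P p -> P q -> p.1 <= q.1 -> q.2 <= p.2;
  arc_antitone2 : forall p q, P p -> P q -> p.2 <= q.2 -> q.1 <= p.1;
  arc_steep1 : forall p q, P p -> P q -> p.1 <= q.1 ->
    p.2 - q.2 <= W * (q.1 - p.1);
  arc_steep2 : forall p q, P p -> P q -> p.2 <= q.2 ->
    p.1 - q.1 <= W * (q.2 - p.2);
  arc_convex1 : forall p q t, P p -> P q -> 0 < t < 1 ->
    exists2 r, P r & r.1 = t * p.1 + (1 - t) * q.1 /\
                     r.2 <= t * p.2 + (1 - t) * q.2;
  arc_convex2 : forall p q t, P p -> P q -> 0 < t < 1 ->
    exists2 r, P r & r.2 = t * p.2 + (1 - t) * q.2 /\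
                     r.1 <= t * p.1 + (1 - t) * q.1 }.

Definition transpose (R : realType) (P : set (R * R)) : set (R * R) :=
  [set p | P (p.2, p.1)].

Lemma convex_arc_transpose (R : realType) (W : R) (P : set (R * R)) :
  convex_arc W P -> convex_arc W (transpose P).
Proof.
case=> [[[x y] Pxy] [K PK] anti1 anti2 steep1 steep2 conv1 conv2]; split.
- by exists (y, x).
- by exists K => p /PK[].
- by move=> p q Pp Pq; exact: anti2 Pp Pq.
- by move=> p q Pp Pq; exact: anti1 Pp Pq.
- by move=> p q Pp Pq; exact: steep2 Pp Pq.
- by move=> p q Pp Pq; exact: steep1 Pp Pq.
- move=> p q t Pp Pq t01; have [r Pr rE] := conv2 _ _ _ Pp Pq t01.
  by exists (r.2, r.1) => //; rewrite /transpose/= -surjective_pairing.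
- move=> p q t Pp Pq t01; have [r Pr rE] := conv1 _ _ _ Pp Pq t01.
  by exists (r.2, r.1) => //; rewrite /transpose/= -surjective_pairing.
Qed.

(** The concave function with slope W on the negative half-line and slope 1 on
    the positive one. *)
Definition wedge (R : realType) (W w : R) : R := Num.min (W * w) w.

(** If the arc is the graph of alpha, this is the supremal convolution of
    - alpha with the wedge: its slope at x is that of - alpha, clamped to
    [1, W]. *)
Definition clamped (R : realType) (W : R) (P : set (R * R)) (x : R) : R :=
  sup [set - p.2 + wedge W (x - p.1) | p in P].

Lemma wedge_slope (R : realType) (W w d : R) : 1 <= W -> 0 <= d ->
  wedge W w + d <= wedge W (w + d) <= wedge W w + W * d.
Proof.
rewrite /wedge => W1 d0; have Wd : d <= W * d by rewrite ler_peMl.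
by rewrite mulrDr; case: (leP (W * w) w); case: (leP (W * w + W * d) (w + d)); lra.
Qed.

Lemma wedge_concave (R : realType) (W w w' t : R) : 0 < t < 1 ->
  t * wedge W w + (1 - t) * wedge W w' <= wedge W (t * w + (1 - t) * w').
Proof.
move=> /andP[t0 t1]; have t1' : 0 < 1 - t by rewrite subr_gt0.
rewrite /wedge le_min; apply/andP; split.
  rewrite mulrDr mulrCA [W * (_ * _)]mulrCA lerD// ler_pM2l//.
  - by rewrite ge_min lexx.
  - by rewrite ge_min lexx.
by rewrite lerD// ler_pM2l// ge_min lexx orbT.
Qed.

Lemma wedge_ge0 (R : realType) (W w : R) : 1 <= W -> 0 <= w -> wedge W w = w.
Proof. by move=> W1 w0; rewrite /wedge min_r// ler_peMl. Qed.

Lemma clamped_ge (R : realType) (W x : R) (P : set (R * R)) (p : R * R) :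
  convex_arc W P -> P p -> - p.2 + wedge W (x - p.1) <= clamped W P x.
Proof.
move=> arcP Pp; apply: ub_le_sup; last by exists p.
have [K PK] := arc_bounded arcP; exists (- K + (x - K)) => _ [q /PK[q1 q2] <-].
have : wedge W (x - q.1) <= x - q.1 by rewrite ge_min lexx orbT.
lra.
Qed.

Lemma clamped_le (R : realType) (W x y : R) (P : set (R * R)) :
  convex_arc W P -> (forall p, P p -> - p.2 + wedge W (x - p.1) <= y) ->
  clamped W P x <= y.
Proof.
move=> arcP Py; apply: ge_sup.
  by have [p Pp] := arc_nonempty arcP; eexists; exists p.
by move=> _ [p Pp <-]; exact: Py.
Qed.

(** A supremum of translates of the wedge inherits its slope bounds. *)
Lemma clamped_slope (R : realType) (W x x' : R) (P : set (R * R)) :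
  1 <= W -> convex_arc W P -> x <= x' ->
  x' - x <= clamped W P x' - clamped W P x <= W * (x' - x).
Proof.
move=> W1 arcP xx'; have d0 : 0 <= x' - x by rewrite subr_ge0.
have ws z := wedge_slope (x - z) W1 d0.
have xE z : x - z + (x' - x) = x' - z by ring.
apply/andP; split.
  suff : clamped W P x <= clamped W P x' - (x' - x) by lra.
  apply: clamped_le => // p Pp; have := clamped_ge x' arcP Pp.
  by have := ws p.1; rewrite xE => /andP[]; lra.
suff : clamped W P x' <= clamped W P x + W * (x' - x) by lra.
apply: clamped_le => // p Pp; have := clamped_ge x arcP Pp.
by have := ws p.1; rewrite xE => /andP[]; lra.
Qed.

(** A convex combination of two competitors p and q is dominated by the point of
    the arc with the combined abscissa. *)
Lemma clamped_concave (R : realType) (W x x' t : R) (P : set (R * R)) :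
  convex_arc W P -> 0 < t < 1 ->
  t * clamped W P x + (1 - t) * clamped W P x' <=
  clamped W P (t * x + (1 - t) * x').
Proof.
move=> arcP t01; have /andP[t0 t1] := t01.
have t1' : 0 < 1 - t by rewrite subr_gt0.
rewrite -lerBrDr -ler_pdivlMl//; apply: clamped_le => // p Pp.
rewrite ler_pdivlMl// lerBrDr addrC -lerBrDr -ler_pdivlMl//.
apply: clamped_le => // q Pq; rewrite ler_pdivlMl// lerBrDr.
have [r Pr [r1 r2]] := arc_convex1 arcP Pp Pq t01.
apply: le_trans (clamped_ge _ arcP Pr); rewrite r1.
have := wedge_concave W (x - p.1) (x' - q.1) t01.
have -> : t * (x - p.1) + (1 - t) * (x' - q.1) =
          t * x + (1 - t) * x' - (t * p.1 + (1 - t) * q.1) by ring.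
lra.
Qed.

Lemma clamped_dr (R : realType) (W x l e : R) (P : set (R * R)) :
  convex_arc W P -> 0 < l -> 0 < e ->
  clamped W P (x + l + e) - clamped W P (x + l) <=
  clamped W P (x + e) - clamped W P x.
Proof.
move=> arcP l0 e0; have le0 : 0 < l + e by rewrite addr_gt0.
have le_neq0 : l + e != 0 by rewrite gt_eqF.
have t01 : 0 < l / (l + e) < 1.
  by rewrite divr_gt0// ltr_pdivrMr// mul1r ltrDl.
have t01' : 0 < e / (l + e) < 1.
  by rewrite divr_gt0// ltr_pdivrMr// mul1r ltrDr.
have := clamped_concave (x + l + e) x arcP t01.
have := clamped_concave (x + l + e) x arcP t01'.
have -> : e / (l + e) * (x + l + e) + (1 - e / (l + e)) * x = x + e by field.
have -> : l / (l + e) * (x + l + e) + (1 - l / (l + e)) * x = x + l by field.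
have -> : e / (l + e) = 1 - l / (l + e) by field.
lra.
Qed.

(** Along the arc the sum of the coordinates is a convex function of the
    abscissa. *)
Lemma arc_between (R : realType) (W : R) (P : set (R * R)) (p q r : R * R) :
  convex_arc W P -> P p -> P q -> P r -> p.1 <= r.1 -> r.1 <= q.1 ->
  r.1 + r.2 <= p.1 + p.2 \/ r.1 + r.2 <= q.1 + q.2.
Proof.
move=> arcP Pp Pq Pr pr rq.
have same u v : P u -> P v -> u.1 = v.1 -> u.2 = v.2.
  move=> Pu Pv uv; apply/eqP; rewrite eq_le; apply/andP; split.
    by apply: (arc_antitone1 arcP Pv Pu); rewrite uv.
  by apply: (arc_antitone1 arcP Pu Pv); rewrite uv.
have [pr_eq|pr_neq] := eqVneq p.1 r.1.
  by left; rewrite (same _ _ Pp Pr pr_eq) pr_eq.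
have [rq_eq|rq_neq] := eqVneq r.1 q.1.
  by right; rewrite (same _ _ Pr Pq rq_eq) rq_eq.
have {}pr : p.1 < r.1 by rewrite lt_neqAle pr_neq.
have {}rq : r.1 < q.1 by rewrite lt_neqAle rq_neq.
have pq : 0 < q.1 - p.1 by lra.
have pq_neq0 : q.1 - p.1 != 0 by rewrite gt_eqF.
have t01 : 0 < (q.1 - r.1) / (q.1 - p.1) < 1.
  have qr : 0 < q.1 - r.1 by lra.
  by rewrite divr_gt0// ltr_pdivrMr// mul1r; lra.
have [s Ps [s1 s2]] := arc_convex1 arcP Pp Pq t01.
have sr : s.1 = r.1 by rewrite s1; field.
have rs : r.1 + r.2 = s.1 + s.2 by rewrite sr (same _ _ Ps Pr sr).
have [pq_sum|qp_sum] := leP (p.1 + p.2) (q.1 + q.2).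
  right; rewrite rs s1; move/andP: t01 => [t0 t1].
  by have := ler_wpM2l (ltW t0) pq_sum; lra.
left; rewrite rs s1; move/andP: t01 => [t0 t1].
have t1' : 0 <= 1 - (q.1 - r.1) / (q.1 - p.1) by lra.
by have := ler_wpM2l t1' (ltW qp_sum); lra.
Qed.

(** Both sides equal the supremum of -(z + w) over the points (z, w) of the arc.
    Indeed, as the arc has slopes between -W and -1 / W, only its points to the
    left of r matter for the first summand on the left-hand side, and only those
    to the right of r for the second one; by convexity z + w cannot be smaller
    than r.1 + r.2 on both sides of r. *)
Lemma clamped_sum_le (R : realType) (W : R) (P : set (R * R)) (r r' : R * R) :
  1 <= W -> convex_arc W P -> P r -> P r' ->
  clamped W P r.1 + clamped W (transpose P) r.2 <=
  clamped W P r'.1 + clamped W (transpose P) r'.2.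
Proof.
move=> W1 arcP Pr Pr'; have arcP' := convex_arc_transpose arcP.
have below z : P z ->
    - (z.1 + z.2) <= clamped W P r'.1 + clamped W (transpose P) r'.2.
  move=> Pz; have Pz' : transpose P (z.2, z.1).
    by rewrite /transpose/= -surjective_pairing.
  have Pr'' : transpose P (r'.2, r'.1).
    by rewrite /transpose/= -surjective_pairing.
  have [zr|rz] := leP z.1 r'.1.
    have := clamped_ge r'.1 arcP Pz; have := clamped_ge r'.2 arcP' Pr''.
    by rewrite /= !wedge_ge0// ?subrr// ?subr_ge0//; lra.
  have zr := arc_antitone1 arcP Pr' Pz (ltW rz).
  have := clamped_ge r'.1 arcP Pr'; have := clamped_ge r'.2 arcP' Pz'.
  by rewrite /= !wedge_ge0// ?subrr// ?subr_ge0//; lra.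
have wedge_steep w : wedge W w <= W * w by rewrite ge_min lexx.
have wedge_flat w : wedge W w <= w by rewrite ge_min lexx orbT.
rewrite -lerBrDr; apply: clamped_le => // p Pp.
rewrite lerBrDr addrC -lerBrDr; apply: clamped_le => // q Pq; rewrite lerBrDr.
have {}Pq : P (q.2, q.1) by [].
have [rp|pr] := leP r.1 p.1.
  have p_term : - p.2 + wedge W (r.1 - p.1) <= - r.2.
    have := wedge_steep (r.1 - p.1); have := arc_steep1 arcP Pr Pp rp; lra.
  have [rq|qr] := leP r.2 q.1.
    have := wedge_steep (r.2 - q.1); have := arc_steep2 arcP Pr Pq rq.
    by have := below _ Pr; rewrite /=; lra.
  by have := wedge_flat (r.2 - q.1); have := below _ Pq; rewrite /=; lra.
have p_term := wedge_flat (r.1 - p.1).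
have [rq|qr] := leP r.2 q.1.
  have := wedge_steep (r.2 - q.1); have := arc_steep2 arcP Pr Pq rq.
  by have := below _ Pp; rewrite /=; lra.
have q_term := wedge_flat (r.2 - q.1).
have rq := arc_antitone2 arcP Pq Pr (ltW qr).
have := below _ Pp; have := below _ Pq.
by case: (arc_between arcP Pp Pq Pr (ltW pr) rq) => /=; lra.
Qed.

Lemma clamped_sum (R : realType) (W : R) (P : set (R * R)) :
  1 <= W -> convex_arc W P -> exists T, forall x y, P (x, y) ->
  clamped W P x + clamped W (transpose P) y = T.
Proof.
move=> W1 arcP; have [r Pr] := arc_nonempty arcP.
exists (clamped W P r.1 + clamped W (transpose P) r.2) => x y Pxy.
apply/eqP; rewrite eq_le; apply/andP; split.
  exact: (clamped_sum_le W1 arcP Pxy Pr).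
exact: (clamped_sum_le W1 arcP Pr Pxy).
Qed.

(** * Functions with kinks on a level set *)

Definition slopes (R : realType) (q p : R) (h : R -> R) : Prop :=
  forall x x', x <= x' -> q * (x' - x) <= h x' - h x <= p * (x' - x).

Definition dr_line (R : realType) (h : R -> R) : Prop :=
  forall x l e, 0 < l -> 0 < e -> h (x + l + e) - h (x + l) <= h (x + e) - h x.

(** Without the linear term, h1 x + h2 y cut off at the level T; the constant
    makes the value at the origin zero. *)
Definition ceiling (R : realType) (lam T : R) (h1 h2 : R -> R) (x y : R) : R :=
  lam * (x + y) + Num.min (h1 x + h2 y) T - Num.min (h1 0 + h2 0) T.

(** The two admissible slope ranges: either h1 and h2 increase and no linear
    term is needed, or they decrease and the linear term restores monotony. In
    both cases the resulting slopes lie between 0 and W. *)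
Definition admissible (R : realType) (W lam : R) (h1 h2 : R -> R) : Prop :=
  [/\ lam = 0, slopes 1 W h1 & slopes 1 W h2] \/
  [/\ lam = W, slopes (- W) (- 1) h1 & slopes (- W) (- 1) h2].

Lemma ceiling_swap (R : realType) (lam T : R) (h1 h2 : R -> R) :
  ceiling lam T h2 h1 = fun x y => ceiling lam T h1 h2 y x.
Proof.
apply/funext => x; apply/funext => y; rewrite /ceiling.
by rewrite (addrC x) (addrC (h2 x)) (addrC (h2 0)).
Qed.

Lemma admissible_swap (R : realType) (W lam : R) (h1 h2 : R -> R) :
  admissible W lam h1 h2 -> admissible W lam h2 h1.
Proof. by case=> -[]; [left|right]. Qed.

Lemma ceiling_mono1 (R : realType) (W lam T : R) (h1 h2 : R -> R) (x x' y : R) :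
  1 <= W -> admissible W lam h1 h2 -> x <= x' ->
  0 <= ceiling lam T h1 h2 x' y - ceiling lam T h1 h2 x y <= (x' - x) * W.
Proof.
rewrite /ceiling => W1 + xx'.
have Wx : 0 <= (W - 1) * (x' - x) by rewrite mulr_ge0 ?subr_ge0.
case=> -[-> /(_ _ _ xx')/andP[h1l h1u] _].
  by case: (leP (h1 x + _) T); case: (leP (h1 x' + _) T) => ? ?; apply/andP; lra.
by case: (leP (h1 x + _) T); case: (leP (h1 x' + _) T) => ? ?; apply/andP; lra.
Qed.

Lemma ceiling_dr1 (R : realType) (W lam T : R) (h1 h2 : R -> R) (x y l e : R) :
  1 <= W -> admissible W lam h1 h2 -> dr_line h1 -> 0 < l -> 0 < e ->
  ceiling lam T h1 h2 (x + l + e) y - ceiling lam T h1 h2 (x + l) y <=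
  ceiling lam T h1 h2 (x + e) y - ceiling lam T h1 h2 x y.
Proof.
rewrite /ceiling => W1 adm dr l0 e0; have {}dr := dr x l e l0 e0.
have [xl xe xle] : [/\ x <= x + l, x <= x + e & x + l <= x + l + e] by split; lra.
have Wl : 0 <= (W - 1) * l by rewrite mulr_ge0 ?subr_ge0// ltW.
have We : 0 <= (W - 1) * e by rewrite mulr_ge0 ?subr_ge0// ltW.
have mono : (h1 x <= h1 (x + l) /\ h1 (x + l) <= h1 (x + l + e)) \/
            (h1 (x + l) <= h1 x /\ h1 (x + l + e) <= h1 (x + l)).
  case: adm => -[_ sl _]; [left|right];
  by have /andP[? ?] := sl _ _ xl; have /andP[? ?] := sl _ _ xle; lra.
case: (leP (h1 (x + l + e) + _) T); case: (leP (h1 (x + l) + _) T);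
case: (leP (h1 (x + e) + _) T); case: (leP (h1 x + _) T) => ? ? ? ?;
by case: mono => -[? ?]; lra.
Qed.

(** Cutting off is concave, and h1 and h2 are monotone in the same direction. *)
Lemma ceiling_submod (R : realType) (W lam T : R) (h1 h2 : R -> R)
    (x x' y y' : R) :
  1 <= W -> admissible W lam h1 h2 -> x <= x' -> y <= y' ->
  ceiling lam T h1 h2 x y + ceiling lam T h1 h2 x' y' <=
  ceiling lam T h1 h2 x y' + ceiling lam T h1 h2 x' y.
Proof.
rewrite /ceiling => W1 adm xx' yy'.
have Wx : 0 <= (W - 1) * (x' - x) by rewrite mulr_ge0 ?subr_ge0.
have Wy : 0 <= (W - 1) * (y' - y) by rewrite mulr_ge0 ?subr_ge0.
have mono : (h1 x <= h1 x' /\ h2 y <= h2 y') \/ (h1 x' <= h1 x /\ h2 y' <= h2 y).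
  case: adm => -[_ s1 s2]; [left|right];
  by have /andP[? ?] := s1 _ _ xx'; have /andP[? ?] := s2 _ _ yy'; lra.
case: (leP (h1 x + h2 y) T); case: (leP (h1 x' + h2 y) T);
case: (leP (h1 x + h2 y') T); case: (leP (h1 x' + h2 y') T) => ? ? ? ?;
by case: mono => -[? ?]; lra.
Qed.

Lemma ceiling_el (R : realType) (W lam T : R) (h1 h2 : R -> R) :
  1 <= W -> admissible W lam h1 h2 -> dr_line h1 -> dr_line h2 ->
  el_fun (ceiling lam T h1 h2).
Proof.
move=> W1 adm dr1 dr2; have adm' := admissible_swap adm; split.
- by rewrite /ceiling addr0 mulr0 add0r subrr.
- move=> x x' y y' _ xx' _ yy'.
  have /andP[+ _] := ceiling_mono1 T y W1 adm xx'.
  have /andP[+ _] := ceiling_mono1 T x' W1 adm' yy'.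
  by rewrite ceiling_swap; lra.
- by move=> x x' y y' _ xx' _ yy'; exact: (ceiling_submod T W1 adm).
- by move=> x y l e _ _ l0 e0; exact: (ceiling_dr1 T x y W1 adm dr1).
- move=> x y l e _ _ l0 e0.
  by have := ceiling_dr1 T y x W1 adm' dr2 l0 e0; rewrite ceiling_swap.
Qed.

(** On the level T one of the one-sided slopes is exactly lam, and the other
    differs from it by a slope of h1, which is at least 1 in absolute value. *)
Lemma ceiling_kink1 (R : realType) (W lam T : R) (h1 h2 : R -> R) (x y : R) :
  1 <= W -> admissible W lam h1 h2 -> h1 x + h2 y = T ->
  kink (fun s => ceiling lam T h1 h2 s y) x.
Proof.
rewrite /ceiling => W1 adm hT; case: adm => -[-> sl _].
  exists 1, 0; split; first lra.
  - move=> e /andP[e0 _]; have xe : x - e <= x by lra.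
    have /andP[] := sl _ _ xe.
    by case: (leP (h1 x + _) T); case: (leP (h1 (x - e) + _) T); lra.
  - move=> e e0; have xe : x <= x + e by lra.
    have /andP[] := sl _ _ xe.
    by case: (leP (h1 x + _) T); case: (leP (h1 (x + e) + _) T); lra.
exists W, (W - 1); split; first lra.
- move=> e /andP[e0 _]; have xe : x - e <= x by lra.
  have /andP[] := sl _ _ xe.
  by case: (leP (h1 x + _) T); case: (leP (h1 (x - e) + _) T); lra.
- move=> e e0; have xe : x <= x + e by lra.
  have /andP[] := sl _ _ xe.
  by case: (leP (h1 x + _) T); case: (leP (h1 (x + e) + _) T); lra.
Qed.

(** The ceiling function is feasible because S lies on the level T of h1 + h2. *)
Lemma OPT_le_of_level (R : realType) (S : set 'rV[R]_2) (W lam T : R)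
    (h1 h2 : R -> R) :
  1 <= W -> admissible W lam h1 h2 -> dr_line h1 -> dr_line h2 ->
  (forall x y, S (pt x y) -> h1 x + h2 y = T) ->
  (OPT S <= W%:E)%E.
Proof.
move=> W1 adm dr1 dr2 hT; have adm' := admissible_swap adm.
pose f (v : 'rV[R]_2) := ceiling lam T h1 h2 (v 0 0) (v 0 1).
have fpt x y : f (pt x y) = ceiling lam T h1 h2 x y by rewrite /f pt0 pt1.
have curry : (fun x y => f (pt x y)) = ceiling lam T h1 h2.
  by apply/funext => x; apply/funext => y.
have elf : entropy_like f.
  by apply/entropy_like_curry; rewrite curry; exact: ceiling_el adm dr1 dr2.
have feasf : feasible S f.
  apply/(feasible_kinks S elf) => x y Sxy _ _.
  rewrite (_ : (fun s => f (pt s y)) = fun s => ceiling lam T h1 h2 s y); last first.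
    by apply/funext => s.
  rewrite (_ : (fun t => f (pt x t)) = fun t => ceiling lam T h2 h1 t x); last first.
    by apply/funext => t; rewrite ceiling_swap.
  split; first by apply: (ceiling_kink1 W1 adm); exact: hT.
  by apply: (ceiling_kink1 W1 adm'); rewrite addrC; exact: hT.
apply: le_trans (_ : Cost f <= W%:E)%E.
  by apply: ereal_inf_lbound; exists f.
apply/(Cost_le _ elf) => h h0; rewrite !fpt.
have c0 : ceiling lam T h1 h2 0 0 = 0.
  by rewrite /ceiling addr0 mulr0 add0r subrr.
have /andP[_] := ceiling_mono1 T 0 W1 adm (ltW h0).
have /andP[_] := ceiling_mono1 T 0 W1 adm' (ltW h0).
by rewrite ceiling_swap c0 !subr0.
Qed.

(** * Decreasing graphs with supporting lines *)

Record dec_graph (R : realType) (a b : R) (alpha beta : R -> R) : Prop :=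
    DecGraph {
  graph_range1 : forall x, 0 <= x <= a -> 0 <= alpha x <= b;
  graph_range2 : forall y, 0 <= y <= b -> 0 <= beta y <= a;
  graphK1 : forall x, 0 <= x <= a -> beta (alpha x) = x;
  graphK2 : forall y, 0 <= y <= b -> alpha (beta y) = y;
  graph_decr1 : forall x x', 0 <= x <= a -> 0 <= x' <= a -> x < x' ->
    alpha x' < alpha x;
  graph_decr2 : forall y y', 0 <= y <= b -> 0 <= y' <= b -> y < y' ->
    beta y' < beta y }.

Lemma dec_graph_swap (R : realType) (a b : R) (alpha beta : R -> R) :
  dec_graph a b alpha beta -> dec_graph b a beta alpha.
Proof. by case. Qed.

Lemma dec_graph_le (R : realType) (a b : R) (alpha beta : R -> R) (x x' : R) :
  dec_graph a b alpha beta -> 0 <= x <= a -> 0 <= x' <= a -> x <= x' ->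
  alpha x' <= alpha x.
Proof.
move=> gr xa x'a; rewrite le_eqVlt => /orP[/eqP->//|xx'].
exact/ltW/(graph_decr1 gr).
Qed.

Lemma dec_graph_interior (R : realType) (a b : R) (alpha beta : R -> R) (x : R) :
  dec_graph a b alpha beta -> 0 < x < a -> 0 < alpha x < b.
Proof.
move=> gr /andP[x0 xa].
have [i0 ia ix] : [/\ 0 <= (0 : R) <= a, 0 <= a <= a & 0 <= x <= a] by split; lra.
have := graph_decr1 gr ix ia xa; have := graph_decr1 gr i0 ix x0.
have := graph_range1 gr i0; have := graph_range1 gr ia; lra.
Qed.

(** The inverse of a decreasing convex function is convex, and that of a
    decreasing concave function is concave. *)
Lemma jensen_inverse (R : realType) (a b sigma : R) (alpha beta : R -> R) :
  dec_graph a b alpha beta -> sigma = 1 \/ sigma = - 1 ->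
  jensen a (fun x => sigma * alpha x) -> jensen b (fun y => sigma * beta y).
Proof.
move=> gr sg conv y y' t yb y'b t01.
have convex_comb c u v : 0 <= u <= c -> 0 <= v <= c ->
    0 <= t * u + (1 - t) * v <= c.
  move=> /andP[u0 uc] /andP[v0 vc]; move/andP: t01 => [t0 t1].
  have t1' : 0 < 1 - t by lra.
  rewrite addr_ge0 ?mulr_ge0 ?(ltW t0) ?(ltW t1')//=.
  by have := ler_wpM2l (ltW t0) uc; have := ler_wpM2l (ltW t1') vc; lra.
have zy := convex_comb _ _ _ yb y'b.
have [ba b'a] := (graph_range2 gr yb, graph_range2 gr y'b).
have zx := convex_comb _ _ _ ba b'a.
have := conv _ _ _ ba b'a t01; rewrite !(graphK2 gr)//.
case: sg => ->.
  rewrite !mul1r => low; rewrite leNgt; apply/negP => lt_z.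
  have := graph_decr1 gr zx (graph_range2 gr zy) lt_z.
  by rewrite (graphK2 gr)//; lra.
rewrite !mulN1r => up.
suff : t * beta y + (1 - t) * beta y' <= beta (t * y + (1 - t) * y') by lra.
rewrite leNgt; apply/negP => lt_z.
have := graph_decr1 gr (graph_range2 gr zy) zx lt_z.
by rewrite (graphK2 gr)//; lra.
Qed.

(** A chord violating the bound can be shortened slightly at both ends, so
    that its ends become interior points of the arc. *)
Lemma lipschitz_closed (R : realType) (a b W : R) (alpha beta : R -> R) :
  dec_graph a b alpha beta -> 0 <= W ->
  (forall x x' : R, 0 < x -> x < x' -> x' < a ->
     alpha x - alpha x' <= W * (x' - x)) ->
  forall x x' : R, 0 <= x <= a -> 0 <= x' <= a -> x <= x' ->
     alpha x - alpha x' <= W * (x' - x).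
Proof.
move=> gr W0 lip x x' xa x'a xx'; rewrite leNgt; apply/negP => viol.
have gap0 : 0 <= W * (x' - x) by rewrite mulr_ge0 ?subr_ge0.
have [ya y'a] := (graph_range1 gr xa, graph_range1 gr x'a).
pose eta := (alpha x - alpha x' - W * (x' - x)) / 4.
have eta0 : 0 < eta by rewrite /eta; lra.
pose s := alpha x - eta; pose s' := alpha x' + eta.
have ss' : s' < s by rewrite /s /s' /eta; lra.
have [sb s'b] : 0 <= s <= b /\ 0 <= s' <= b by rewrite /s /s' /eta; lra.
have sy : s < alpha x by rewrite ltrBlDr ltrDl.
have y's' : alpha x' < s' by rewrite ltrDl.
have := graph_decr2 gr s'b sb ss'.
have := graph_decr2 gr sb ya sy; rewrite (graphK1 gr)//.
have := graph_decr2 gr y'a s'b y's'; rewrite (graphK1 gr)//.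
move=> s'x' xs ss.
have := lip (beta s) (beta s'); rewrite !(graphK2 gr)//.
have [-> -> ->] : [/\ 0 < beta s, beta s < beta s' & beta s' < a] by split; lra.
move=> /(_ isT isT isT).
have : beta s' - beta s <= x' - x by lra.
by move=> /(ler_wpM2l W0); rewrite /s /s' /eta in viol *; lra.
Qed.

(** The supporting lines n0 (x' - x) + n1 (y' - y) = 0 have slopes between -W and
    -1 / W. *)
Definition supported (R : realType) (a W sigma : R) (alpha : R -> R) : Prop :=
  forall x : R, 0 < x < a -> exists n0 n1 : R, [/\ 0 < n0, 0 < n1, n0 <= W * n1,
    n1 <= W * n0 & forall x' : R, 0 <= x' <= a ->
      0 <= sigma * (n0 * (x' - x) + n1 * (alpha x' - alpha x))].

Lemma supported_swap (R : realType) (a b W sigma : R) (alpha beta : R -> R) :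
  dec_graph a b alpha beta -> supported a W sigma alpha ->
  supported b W sigma beta.
Proof.
move=> gr supp y yb; have yb' : 0 <= y <= b by lra.
have xa := dec_graph_interior (dec_graph_swap gr) yb.
have [n0 [n1 [n00 n10 nW0 nW1 nsupp]]] := supp _ xa.
exists n1, n0; split=> // y' y'b.
have := nsupp _ (graph_range2 gr y'b); rewrite !(graphK2 gr)//.
by rewrite addrC.
Qed.

(** A chord lies on the prescribed side of the supporting line at its left end
    if sigma = 1, and of that at its right end if sigma = -1. *)
Lemma supported_lipschitz (R : realType) (a b W sigma : R)
    (alpha beta : R -> R) (x x' : R) :
  dec_graph a b alpha beta -> 0 <= W -> sigma = 1 \/ sigma = - 1 ->
  supported a W sigma alpha ->
  0 <= x <= a -> 0 <= x' <= a -> x <= x' ->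
  alpha x - alpha x' <= W * (x' - x).
Proof.
move=> gr W0 sg supp; move: x x'; apply: (lipschitz_closed gr) => // x x' x0 xx' x'a.
have dx : 0 <= x' - x by lra.
case: sg supp => -> supp.
  have xa : 0 < x < a by lra.
  have x'_in : 0 <= x' <= a by apply/andP; split; lra.
  have [n0 [n1 [_ n10 nW _ /(_ _ x'_in) low]]] := supp x xa.
  rewrite -(ler_pM2l n10).
  by have := ler_wpM2r dx nW; lra.
have xa : 0 < x' < a by lra.
have x_in : 0 <= x <= a by apply/andP; split; lra.
have [n0 [n1 [_ n10 nW _ /(_ _ x_in) low]]] := supp x' xa.
rewrite -(ler_pM2l n10).
by have := ler_wpM2r dx nW; lra.
Qed.

(** For sigma = -1 the graph is reflected through the origin, which turns a
    concave arc into a convex one. *)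
Definition signed_arc (R : realType) (a sigma : R) (alpha : R -> R) :
    set (R * R) :=
  [set p | 0 <= sigma * p.1 <= a /\ sigma * p.2 = alpha (sigma * p.1)].

Lemma signed_arc_transpose (R : realType) (a b sigma : R)
    (alpha beta : R -> R) :
  dec_graph a b alpha beta ->
  transpose (signed_arc a sigma alpha) = signed_arc b sigma beta.
Proof.
move=> gr; apply/seteqP; split=> -[y x]; rewrite /transpose /signed_arc/=.
  by move=> [xa ->]; split; [exact: graph_range1 gr _ xa|rewrite (graphK1 gr)].
by move=> [yb ->]; split; [exact: graph_range2 gr _ yb|rewrite (graphK2 gr)].
Qed.

Lemma signed_arc_antitone (R : realType) (a b sigma : R)
    (alpha beta : R -> R) (p q : R * R) :
  dec_graph a b alpha beta -> sigma = 1 \/ sigma = - 1 ->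
  signed_arc a sigma alpha p -> signed_arc a sigma alpha q ->
  p.1 <= q.1 -> q.2 <= p.2.
Proof.
move=> gr sg [pa pE] [qa qE] pq; move: pa pE qa qE.
case: sg => ->; rewrite ?mul1r ?mulN1r => pa pE qa qE.
  by rewrite pE qE; exact: dec_graph_le gr _ _ _.
by rewrite -lerN2 pE qE; apply: (dec_graph_le gr); rewrite ?lerN2.
Qed.

Lemma signed_arc_steep (R : realType) (a b W sigma : R)
    (alpha beta : R -> R) (p q : R * R) :
  dec_graph a b alpha beta -> 0 <= W -> sigma = 1 \/ sigma = - 1 ->
  supported a W sigma alpha ->
  signed_arc a sigma alpha p -> signed_arc a sigma alpha q ->
  p.1 <= q.1 -> p.2 - q.2 <= W * (q.1 - p.1).
Proof.
move=> gr W0 sg supp; have lip := supported_lipschitz gr W0 sg supp.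
move=> [pa pE] [qa qE] pq; move: pa pE qa qE lip.
case: sg => ->; rewrite ?mul1r ?mulN1r => pa pE qa qE lip.
  by rewrite pE qE; exact: lip.
have := lip _ _ qa pa; rewrite lerN2 => /(_ pq); rewrite -pE -qE; lra.
Qed.

Lemma signed_arc_convex (R : realType) (a sigma : R) (alpha : R -> R)
    (p q : R * R) (t : R) :
  sigma = 1 \/ sigma = - 1 ->
  jensen a (fun x => sigma * alpha x) ->
  signed_arc a sigma alpha p -> signed_arc a sigma alpha q -> 0 < t < 1 ->
  exists2 r, signed_arc a sigma alpha r &
    r.1 = t * p.1 + (1 - t) * q.1 /\ r.2 <= t * p.2 + (1 - t) * q.2.
Proof.
move=> sg conv [pa pE] [qa qE] t01; set z := t * p.1 + _.
have ss : sigma * sigma = 1 by case: sg => ->; ring.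
have sK u : sigma * (sigma * u) = u by rewrite mulrA ss mul1r.
have zE : sigma * z = t * (sigma * p.1) + (1 - t) * (sigma * q.1).
  by rewrite /z; ring.
exists (z, sigma * alpha (sigma * z)); last first.
  split=> //=; rewrite zE; apply: le_trans (conv _ _ _ pa qa t01) _.
  by rewrite -pE -qE !sK.
split=> /=; last by rewrite sK.
rewrite zE; move/andP: t01 => [t0 t1]; have t1' : 0 < 1 - t by lra.
move/andP: pa => [p0 pa]; move/andP: qa => [q0 qa].
have := mulr_ge0 (ltW t0) p0; have := mulr_ge0 (ltW t1') q0.
by have := ler_wpM2l (ltW t0) pa; have := ler_wpM2l (ltW t1') qa; lra.
Qed.

Lemma signed_arc_convex_arc (R : realType) (a b W sigma : R)
    (alpha beta : R -> R) :
  0 <= a -> dec_graph a b alpha beta -> 1 <= W -> sigma = 1 \/ sigma = - 1 ->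
  jensen a (fun x => sigma * alpha x) -> supported a W sigma alpha ->
  convex_arc W (signed_arc a sigma alpha).
Proof.
move=> a0 gr W1 sg conv supp; have gr' := dec_graph_swap gr.
have W0 : 0 <= W := le_trans ler01 W1.
have conv' := jensen_inverse gr sg conv; have supp' := supported_swap gr supp.
have tr p : signed_arc a sigma alpha p -> signed_arc b sigma beta (p.2, p.1).
  by rewrite -(signed_arc_transpose _ gr) /transpose/= -surjective_pairing.
have ss : sigma * sigma = 1 by case: sg => ->; ring.
split.
- exists (0, sigma * alpha 0); split=> /=; first by rewrite mulr0 lexx.
  by rewrite mulr0 mulrA ss mul1r.
- exists (- (a + b)) => p Pp; have [pa _] := Pp; have [pb _] := tr _ Pp.
  by move: pa pb; case: sg => ->; rewrite /= ?mul1r ?mulN1r; lra.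
- by move=> p q; exact: signed_arc_antitone gr sg.
- by move=> p q /tr Pp /tr Pq; exact: (signed_arc_antitone gr' sg Pp Pq).
- by move=> p q; exact: signed_arc_steep gr W0 sg supp.
- by move=> p q /tr Pp /tr Pq; exact: (signed_arc_steep gr' W0 sg supp' Pp Pq).
- by move=> p q t; exact: (signed_arc_convex sg conv).
- move=> p q t /tr Pp /tr Pq t01.
  have [r Pr rE] := signed_arc_convex sg conv' Pp Pq t01.
  exists (r.2, r.1) => //.
  by move: Pr; rewrite -(signed_arc_transpose _ gr).
Qed.

Lemma OPT_le (R : realType) (S : set 'rV[R]_2) (a b W sigma : R)
    (alpha beta : R -> R) :
  0 <= a -> dec_graph a b alpha beta -> 1 <= W -> sigma = 1 \/ sigma = - 1 ->
  jensen a (fun x => sigma * alpha x) -> supported a W sigma alpha ->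
  S = [set pt x (alpha x) | x in `[0, a]] -> (OPT S <= W%:E)%E.
Proof.
move=> a0 gr W1 sg conv supp SE.
have arcP := signed_arc_convex_arc a0 gr W1 sg conv supp.
set P := signed_arc a sigma alpha in arcP.
have arcP' := convex_arc_transpose arcP.
have [T hT] := clamped_sum W1 arcP.
pose h1 x := clamped W P (sigma * x).
pose h2 y := clamped W (transpose P) (sigma * y).
have dr (Q : set (R * R)) : convex_arc W Q ->
    dr_line (fun x => clamped W Q (sigma * x)).
  move=> arcQ x l e l0 e0; case: sg => ->.
    by rewrite !mul1r; exact: clamped_dr.
  have := clamped_dr (- x - l - e) arcQ l0 e0; rewrite !mulN1r.
  have -> : - x - l - e + l + e = - x by ring.
  have -> : - x - l - e + l = - (x + e) by ring.
  have -> : - x - l - e + e = - (x + l) by ring.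
  have -> : - x - l - e = - (x + l + e) by ring.
  lra.
have level x y : S (pt x y) -> h1 x + h2 y = T.
  move=> Sxy; apply: hT; split=> /=; move: Sxy; rewrite SE => -[z /=];
  have ss u : sigma * (sigma * u) = u by case: sg => ->; lra.
    by rewrite in_itv/= => za /rowP/(_ 0); rewrite !pt0 ss => <-.
  move=> _ /[dup] /rowP/(_ 0) + /rowP/(_ 1).
  by rewrite !pt0 !pt1 !ss => <- <-.
case: (sg) => sE.
  apply: (OPT_le_of_level W1 _ (dr _ arcP) (dr _ arcP') level).
  by left; split; rewrite // => x x' xx'; rewrite mul1r /h1 /h2 sE !mul1r;
    exact: clamped_slope.
apply: (OPT_le_of_level (lam := W) W1 _ (dr _ arcP) (dr _ arcP') level).
have neg (Q : set (R * R)) : convex_arc W Q ->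
    slopes (- W) (- 1) (fun x => clamped W Q (sigma * x)).
  move=> arcQ x x' xx'; rewrite sE !mulN1r.
  have : - x' <= - x by rewrite lerN2.
  by move=> /(clamped_slope W1 arcQ); lra.
by right; split=> //; exact: neg.
Qed.

(** * The two bounds *)

(** Convexity or concavity makes all secants on one side of x at least as steep
    as the supporting line at x. *)
Lemma normal_ratio_le (R : realType) (F : R -> R -> R) (alpha : R -> R)
    (a sigma x n0 n1 M : R) :
  el_fun F -> (forall h, 0 < h -> F h 0 <= h * M) ->
  sigma = 1 \/ sigma = - 1 -> jensen a (fun x => sigma * alpha x) ->
  (forall x, 0 <= x <= a -> 0 <= alpha x) ->
  (forall x, 0 < x < a -> kink (F x) (alpha x)) ->
  0 < x < a -> 0 < n0 -> 0 < n1 ->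
  (forall x' : R, 0 <= x' <= a ->
     0 <= sigma * (n0 * (x' - x) + n1 * (alpha x' - alpha x))) ->
  n0 <= M * n1.
Proof.
move=> elF FM sg conv alpha0 kinks /andP[x0 xa] n00 n10 supp.
rewrite -ler_pdivrMr//.
have nE u v : n0 * u <= n1 * v -> n0 / n1 * u <= v.
  by rewrite mulrAC ler_pdivrMr// [v * _]mulrC.
case: sg conv supp => -> conv supp.
  apply: (@secant_slope_le _ F alpha (x / 2) x) => //; rewrite ?divr_gt0//; try lra.
  - by move=> u ux; apply: alpha0; lra.
  - move=> u v xu uv vx.
    have sec : n0 / n1 * (x - u) <= alpha u - alpha x.
      by apply: nE; have := supp u (ltac:(lra)); lra.
    have [vE|v_neq] := eqVneq v x; first by rewrite vE.
    have vx' : v < x by rewrite lt_neqAle v_neq.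
    have xu0 : 0 < x - u by lra.
    have t01 : 0 < (x - v) / (x - u) < 1.
      have xv0 : 0 < x - v by lra.
      by rewrite divr_gt0// ltr_pdivrMr// mul1r; lra.
    have := conv u x _ (ltac:(lra)) (ltac:(lra)) t01.
    set t := (x - v) / (x - u) in t01 *.
    have tE : (1 - t) * (x - u) = v - u by rewrite /t; field; lra.
    have -> : t * u + (1 - t) * x = v by move: tE; lra.
    have t1 : 0 <= 1 - t by lra.
    by have := ler_wpM2l t1 sec; rewrite mulrCA tE; lra.
  - by move=> u ux; apply: kinks; lra.
apply: (@secant_slope_le _ F alpha x ((x + a) / 2)) => //; rewrite ?divr_gt0//; try lra.
- by move=> u ux; apply: alpha0; lra.
- move=> u v xu uv vx.
  have sec : n0 / n1 * (v - x) <= alpha x - alpha v.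
    by apply: nE; have := supp v (ltac:(lra)); lra.
  have [uE|u_neq] := eqVneq x u; first by rewrite -uE.
  have xu' : x < u by rewrite lt_neqAle u_neq.
  have xv0 : 0 < v - x by lra.
  have t01 : 0 < (v - u) / (v - x) < 1.
    have uv0 : 0 < v - u by lra.
    by rewrite divr_gt0// ltr_pdivrMr// mul1r; lra.
  have := conv x v _ (ltac:(lra)) (ltac:(lra)) t01.
  set t := (v - u) / (v - x) in t01 *.
  have tE : t * (v - x) = v - u by rewrite /t; field; lra.
  have -> : t * x + (1 - t) * v = u by move: tE; lra.
  have t0 : 0 <= t by lra.
  by have := ler_wpM2l t0 sec; rewrite mulrCA tE; lra.
- by move=> u ux; apply: kinks; lra.
Qed.

Theorem mainTheorem3 (R : realType) (S D : set 'rV[R]_2) (a b : R)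
    (alpha beta : R -> R)
    (hS : s_surface S D)
    (ha : 0 < a) (hb : 0 < b)
    (alpha_bij : set_bij `[0, a] `[0, b] alpha)
    (beta_bij : set_bij `[0, b] `[0, a] beta)
    (alphaK : {in `[0, a], cancel alpha beta})
    (betaK : {in `[0, b], cancel beta alpha})
    (alpha_decr : strictly_decreasing_on `[0, a] alpha)
    (beta_decr : strictly_decreasing_on `[0, b] beta)
    (S_alpha : S = [set pt x (alpha x) | x in `[0, a]])
    (S_beta : S = [set pt (beta y) y | y in `[0, b]])
    (hconv : strictly_convex_on `[0, a] alpha \/
             strictly_concave_on `[0, a] alpha) :
  OPT S = ereal_sup
    [set r | exists (p : 'rV[R]_2) (i j : 'I_2),
       [/\ S p, interior_pt p &
           r = (outward_normal S D p 0 j / outward_normal S D p 0 i)%:E]].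
Proof.
have itvE c (x : R) : [set` `[0, c]] x = (0 <= x <= c) by rewrite /= in_itv.
have gr : dec_graph a b alpha beta.
  have [alpha_fun _ _] := alpha_bij; have [beta_fun _ _] := beta_bij.
  split.
  - by move=> x; rewrite -!itvE; exact: alpha_fun.
  - by move=> y; rewrite -!itvE; exact: beta_fun.
  - by move=> x; rewrite -itvE; exact: alphaK.
  - by move=> y; rewrite -itvE; exact: betaK.
  - by move=> x x'; rewrite -!itvE; exact: alpha_decr.
  - by move=> y y'; rewrite -!itvE; exact: beta_decr.
have [sigma [sg conv]] : exists sigma : R, (sigma = 1 \/ sigma = - 1) /\
    jensen a (fun x => sigma * alpha x).
  have weak h : strictly_convex_on `[0, a] h -> jensen a h.
    move=> hc x y t xa ya t01; have [->|xy] := eqVneq x y.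
      by rewrite -!mulrDl addrC subrK !mul1r.
    by rewrite -itvE in xa; rewrite -itvE in ya; exact/ltW/hc.
  case: hconv => /weak conv; [exists 1|exists (- 1)]; split; try by [left|right].
    by under eq_fun do rewrite mul1r.
  by under eq_fun do rewrite mulN1r.
have onS p : S p <-> 0 <= p 0 0 <= a /\ p 0 1 = alpha (p 0 0).
  rewrite S_alpha; split=> [[x] + <-|[pa pE]].
    by rewrite itvE pt0 pt1.
  by exists (p 0 0); rewrite ?itvE// -pE pt_coords.
have intS x : 0 < x < a -> S (pt x (alpha x)) /\ interior_pt (pt x (alpha x)).
  move=> xa; have /andP[y0 _] := dec_graph_interior gr xa.
  split; first by apply/onS; rewrite pt0 pt1; split=> //; lra.
  by move=> i; case: (ord2P i) => ->; rewrite ?pt0 ?pt1//; lra.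
have intP p : S p -> interior_pt p -> 0 < p 0 0 < a /\ 0 < p 0 1 < b.
  move=> /onS[/andP[p0 pa] pE] ip; have := ip 0; have := ip 1 => y0 x0.
  have xa : 0 < p 0 0 < a.
    rewrite x0 lt_neqAle pa andbT; apply/eqP => xa.
    have [aa oa] : 0 <= a <= a /\ 0 <= beta 0 <= a.
      by split; [lra|apply: (graph_range2 gr); lra].
    have /andP[_ oa'] := oa.
    have : p 0 1 <= alpha (beta 0) by rewrite pE xa; exact: (dec_graph_le gr).
    by rewrite (graphK2 gr); lra.
  by split=> //; rewrite pE; exact: dec_graph_interior gr xa.
set N := outward_normal S D.
have Npos p : S p -> 0 < N p 0 0 /\ 0 < N p 0 1.
  by move=> Sp; split; exact: s_surface_normal hS _ Sp _.
have Nsupp p : S p -> interior_pt p -> forall q, S q ->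
    0 <= sigma * (N p 0 0 * (q 0 0 - p 0 0) + N p 0 1 * (q 0 1 - p 0 1)).
  move=> Sp ip; have [n0 n1] := Npos _ Sp; have [pa _] := intP _ Sp ip.
  apply: (normal_supports (D := D) S_alpha) => //.
  move: n0; rewrite /N /outward_normal.
  by case: xgetP => [n -> //|_]; rewrite mxE ltxx.
set W := ereal_sup _.
have ratioW p (i j : 'I_2) : S p -> interior_pt p ->
    ((N p 0 j / N p 0 i)%:E <= W)%E.
  by move=> Sp ip; apply: ereal_sup_ubound; exists p, i, j.
apply/eqP; rewrite eq_le; apply/andP; split.
  have ha2 : 0 < a / 2 < a by lra.
  have [Sm im] := intS _ ha2; have [m0 _] := Npos _ Sm.
  have W1 : (1 <= W)%E.
    by have := ratioW _ 0 0 Sm im; rewrite divff// gt_eqF.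
  move: W1 ratioW; case: (W) => [w| |]// w1 ratioW; last by rewrite leey.
  apply: (OPT_le (ltW ha) gr _ sg conv _ S_alpha) => //.
  move=> x xa; have [Sx ix] := intS _ xa; have [n0 n1] := Npos _ Sx.
  exists (N (pt x (alpha x)) 0 0), (N (pt x (alpha x)) 0 1); split=> //.
  - by have := ratioW _ 1 0 Sx ix; rewrite lee_fin ler_pdivrMr.
  - by have := ratioW _ 0 1 Sx ix; rewrite lee_fin ler_pdivrMr.
  - move=> x' x'a; have := Nsupp _ Sx ix (pt x' (alpha x')).
    by rewrite !pt0 !pt1; apply; apply/onS; rewrite pt0 pt1.
apply: ge_ereal_sup => r [p [i [j [Sp ip ->]]]] {r}; rewrite -/N.
apply: le_ereal_inf_tmp => c [f [elf feasf] <-] {c}.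
have elF := elf; move/entropy_like_curry in elF.
move/(feasible_kinks S elf) in feasf.
have [pa pb] := intP _ Sp ip; have [n0 n1] := Npos _ Sp.
have [pa' pE] := (onS p).1 Sp.
have pE' : p 0 0 = beta (p 0 1) by rewrite pE (graphK1 gr).
have bound M : (Cost f <= M%:E)%E -> N p 0 0 <= M * N p 0 1 /\
    N p 0 1 <= M * N p 0 0.
  move=> /(Cost_le _ elf) fM; split.
    apply: (normal_ratio_le elF _ sg conv _ _ pa n0 n1) => [h /fM[]//|x|x xa|x xa].
    - by move=> /(graph_range1 gr)/andP[].
    - have [Sx _] := intS _ xa; have /andP[y0 _] := dec_graph_interior gr xa.
      by have /andP[x0 _] := xa; have [_] := feasf _ _ Sx x0 y0.
    - have := Nsupp _ Sp ip (pt x (alpha x)).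
      by rewrite pt0 pt1 -pE; apply; apply/onS; rewrite pt0 pt1.
  have conv' := jensen_inverse gr sg conv.
  have gr' := dec_graph_swap gr.
  apply: (normal_ratio_le (el_fun_swap elF) _ sg conv' _ _ pb n1 n0) =>
    [h /fM[]//|y|y yb|y yb].
  - by move=> /(graph_range1 gr')/andP[].
  - have xa := dec_graph_interior gr' yb; have [Sx _] := intS _ xa.
    have /andP[x0 _] := xa; have /andP[y0 _] := yb.
    move: Sx; rewrite (graphK2 gr); last lra.
    by move=> /feasf/(_ x0 y0)[].
  - have := Nsupp _ Sp ip (pt (beta y) y).
    rewrite pt0 pt1 -pE' addrC; apply; apply/onS; rewrite pt0 pt1 (graphK2 gr)//.
    by split=> //; exact: (graph_range2 gr).
case: (Cost f) bound => [M| |] bound; last 2 first.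
- by rewrite leey.
- by have [+ _] := bound 0 (leNye _); rewrite mul0r leNgt n0.
rewrite lee_fin; have [b0 b1] := bound M (lexx _).
have M1 : 1 <= M.
  have [le01|lt10] := leP (N p 0 0) (N p 0 1).
    rewrite -(ler_pM2r n0) mul1r; exact: le_trans le01 _.
  by rewrite -(ler_pM2r n1) mul1r; exact: le_trans (ltW lt10) _.
by case: (ord2P i) => ->; case: (ord2P j) => ->; rewrite ler_pdivrMr// ler_peMl// ltW.
Qed.
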